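(* Fix an integer $q\geq 2$ and let $\mathbb{X}=\{X_i,i\in\mathbb{N}\}$ be a sequence of centered independent real random variables such that $\mathbb{E}[X_i^2]=1$ for each $i\in\mathbb{N}$ and $\sup\{\mathbb{E}[|X_j|^{2+\delta}]:j\in\mathbb{N}\}<\infty$ for some $\delta>0$. Let $(F_n,n\geq1)$ be a sequence of random variables such that: (i) for each $n\geq1$, $F_n=\mathbb{E}[F_n]+\sum_{p=1}^q Q_p(f_{p,n};\mathbb{X})$ with $f_{p,n}\in\ell^2_0(\mathbb{N})^{\odot p}$ for each $p\in\{1,\dots,q\}$; (ii) $F_n$ converges almost surely to a random variable $F$ of the form $F=\mathbb{E}[F]+\sum_{p=1}^q Q_p(f_p;\mathbb{X})$ with $f_p\in\ell^2_0(\mathbb{N})^{\odot p}$ for each $p\in\{1,\dots,q\}$. Then, as $n\to+\infty$, $\mathbb{E}[F_n]\to\mathbb{E}[F]$, and for each $p\in\{1,\dots,q\}$, $Q_p(f_{p,n};\mathbb{X})$ converges almost surely to $Q_p(f_p;\mathbb{X})$.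
   Context: $\mathbb{N}=\{1,2,\dots\}$. For $p\geq1$, $\ell^2_0(\mathbb{N})^{\odot p}$ is the set of $f\in\ell^2(\mathbb{N})^{\otimes p}$ (i.e. square-summable functions on $\mathbb{N}^p$) that are symmetric in their arguments and vanish on diagonals, i.e. $f(i_1,\dots,i_p)=0$ whenever $i_j=i_k$ for some $j\neq k$. For such $f$, the homogeneous sum of order $p$ is $Q_p(f;\mathbb{X})=\sum_{i_1,\dots,i_p\in\mathbb{N}} f(i_1,\dots,i_p)X_{i_1}\cdots X_{i_p}$, the series converging in $L^2(\mathbb{P})$ since the $X_i$ are independent, centered, with unit variance. *)

(* Defs.v *)
From HB Require Import structures.
From mathcomp Require Import all_boot all_order all_algebra.
From mathcomp Require Import all_classical all_reals all_analysis.
Set Implicit Arguments. Unset Strict Implicit. Unset Printing Implicit Defensive.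
Import Order.TTheory GRing.Theory Num.Theory.
Import numFieldNormedType.Exports.
Local Open Scope classical_set_scope.
Local Open Scope ring_scope.

Definition mutually_independent {d} {T : measurableType d} {R : realType}
  (P : probability T R) (X : nat -> T -> R) : Prop :=
  forall (I : seq nat) (B : nat -> set R), uniq I ->
    (forall i, measurable (B i)) ->
    P (\big[setI/setT]_(i <- I) (X i @^-1` B i)) =
    (\prod_(i <- I) P (X i @^-1` B i))%E.

Definition l2_0_sym {R : realType} (p : nat) (f : ('I_p -> nat) -> R) : Prop :=
  [/\ (forall (s : 'I_p -> 'I_p) (i : 'I_p -> nat), bijective s -> f (i \o s) = f i),
      (forall (i : 'I_p -> nat) (j k : 'I_p), j != k -> i j = i k -> f i = 0) &
      (exists M : R, forall N : nat,
          \sum_(i : {ffun 'I_p -> 'I_N}) (f (fun k => (i k : nat))) ^+ 2 <= M)].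

Definition homsum_partial {T : Type} {R : realType} (X : nat -> T -> R)
  (p : nat) (f : ('I_p -> nat) -> R) (N : nat) : T -> R :=
  fun w => \sum_(i : {ffun 'I_p -> 'I_N})
             f (fun k => (i k : nat)) * \prod_(k < p) X (i k : nat) w.

(* G is (a version of) Q_p(f; X): a measurable function which is the L^2(P)
   limit of the partial sums of the series defining Q_p(f; X). *)
Definition is_homsum {d} {T : measurableType d} {R : realType}
  (P : probability T R) (X : nat -> T -> R) (p : nat)
  (f : ('I_p -> nat) -> R) (G : T -> R) : Prop :=
  measurable_fun setT G /\
  ('E_P[fun w => ((homsum_partial X f N w - G w) ^+ 2)%R] @[N --> \oo] --> 0)%E.

(* Main.v *)
(** Write [H_n = F_n - F = c_n + Q_1(h_n) + ... + Q_q(h_n)] and let [T] halve the variables: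
    [T H_n = sum_p 2^-p Q_p(h_n)]. Each component, including the constant [c_n], is a fixed
    linear combination of iterates of [T] (Lagrange interpolation at the nodes [2^-p]), so
    almost sure convergence of the components follows from the maximal inequality
      P (max_n |T H_n| > C eps) <= D P (max_n |H_n| > eps),
    with constants depending only on [q] and the truncation level of the [X_i].
    To prove it, replace each coordinate [X_i] by an independent copy with probability 1/2;
    the law of [max_n |H_n|] does not change and the conditional mean of [H_n] given [X] is
    [T H_n]. Given [X], each [H_n] is a polynomial of degree at most [q] in independent
    variables, so if [|H_n| > eps] has small conditional probability then the second moment
    of [H_n], hence [|T H_n|], is bounded by a multiple of [eps]; this is proved by pairing
    [H_n] with the polynomial with the same coefficients in bounded variables, whose fourth
    moment is controlled by Bonami's lemma. Markov's inequality over [X] concludes.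
    The inequality is proved on finite product spaces and transferred to the [X_i] by
    discretising them. *)
Require Import Defs.
From HB Require Import structures.
From mathcomp Require Import all_boot all_order all_algebra.
From mathcomp Require Import all_classical all_reals all_analysis.
From mathcomp Require Import measurable_realfun ring lra.
Set Implicit Arguments. Unset Strict Implicit. Unset Printing Implicit Defensive.
Import Order.TTheory GRing.Theory Num.Theory.
Import numFieldNormedType.Exports.
Local Open Scope ring_scope.

(** * Expectations on finite product spaces *)

Definition pmass {R : realFieldType} {I V : finType} (mu : I -> V -> R)
  (w : {ffun I -> V}) : R := \prod_i mu i (w i).

Definition pexp {R : realFieldType} {I V : finType} (mu : I -> V -> R)
  (F : {ffun I -> V} -> R) : R := \sum_w pmass mu w * F w.

Definition upd {I V : finType} (w : {ffun I -> V}) (i : I) (v : V) : {ffun I -> V} :=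
  [ffun j => if j == i then v else w j].

Definition is_pmf {R : realFieldType} {I V : finType} (mu : I -> V -> R) : Prop :=
  (forall i v, 0 <= mu i v) /\ (forall i, \sum_v mu i v = 1).

Section FiniteProduct.
Context {R : realFieldType} {I V : finType} (mu : I -> V -> R).
Hypothesis mu_pmf : is_pmf mu.

Let mu_ge0 := mu_pmf.1.
Let mu_sum1 := mu_pmf.2.

Lemma pmass_ge0 w : 0 <= pmass mu w.
Proof. by apply: prodr_ge0 => i _. Qed.

Lemma eq_pexp F G : F =1 G -> pexp mu F = pexp mu G.
Proof. by move=> FG; apply: eq_bigr => w _; rewrite FG. Qed.

Lemma pexp_ge0 F : (forall w, 0 <= F w) -> 0 <= pexp mu F.
Proof. by move=> F0; apply: sumr_ge0 => w _; rewrite mulr_ge0 ?pmass_ge0. Qed.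

Lemma le_pexp F G : (forall w, F w <= G w) -> pexp mu F <= pexp mu G.
Proof. by move=> FG; apply: ler_sum => w _; rewrite ler_wpM2l ?pmass_ge0. Qed.

Lemma pexpD F G : pexp mu (fun w => F w + G w) = pexp mu F + pexp mu G.
Proof. by rewrite -big_split; apply: eq_bigr => w _; rewrite mulrDr. Qed.

Lemma pexpZ c F : pexp mu (fun w => c * F w) = c * pexp mu F.
Proof. by rewrite mulr_sumr; apply: eq_bigr => w _; rewrite mulrCA. Qed.

Lemma pexp_sum (J : Type) (r : seq J) (Q : pred J) (F : J -> {ffun I -> V} -> R) :
  pexp mu (fun w => \sum_(j <- r | Q j) F j w) = \sum_(j <- r | Q j) pexp mu (F j).
Proof.
rewrite exchange_big; apply: eq_bigr => w _.
by rewrite mulr_sumr.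
Qed.

Lemma pexp_prod (g : I -> V -> R) :
  pexp mu (fun w => \prod_i g i (w i)) = \prod_i \sum_v mu i v * g i v.
Proof.
by rewrite bigA_distr_bigA; apply: eq_bigr => w _; rewrite big_split.
Qed.

Lemma pexp1 : pexp mu (fun=> 1) = 1.
Proof.
transitivity (pexp mu (fun w => \prod_i (fun _ _ => 1) i (w i))).
  by apply: eq_pexp => w; rewrite big1.
rewrite (pexp_prod (fun _ _ => 1)) big1// => i _.
by rewrite -[RHS](mu_sum1 i); apply: eq_bigr => v _; rewrite mulr1.
Qed.

Lemma pexp_cst c : pexp mu (fun=> c) = c.
Proof.
by rewrite -[RHS]mulr1 -pexp1 -pexpZ; apply: eq_pexp => w; rewrite mulr1.
Qed.

Lemma indic_ffun (w t : {ffun I -> V}) :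
  ((w == t)%:R : R) = \prod_i ((w i == t i)%:R : R).
Proof.
case: eqP => [->|/eqP wt]; first by rewrite big1// => i _; rewrite eqxx.
have [i wti] : exists i, w i != t i.
  by apply/existsP; rewrite -negb_forall; apply: contraNN wt => /forallP wt;
     apply/eqP/ffunP => i; apply/eqP.
by rewrite (bigD1 i)//= (negbTE wti) mul0r.
Qed.

(** Point masses factor over the coordinates. Any identity linear in [F] thus reduces to product
    functions, where [pexp_prod] applies. *)
Lemma ffun_expand (F : {ffun I -> V} -> R) w :
  F w = \sum_t F t * \prod_i ((w i == t i)%:R : R).
Proof.
rewrite (bigD1 w)//= -indic_ffun eqxx mulr1 big1 ?addr0// => t tw.
by rewrite -indic_ffun eq_sym (negbTE tw) mulr0.
Qed.

Lemma sum_indic (nu : V -> R) a : \sum_v nu v * (v == a)%:R = nu a.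
Proof.
rewrite (bigD1 a)//= eqxx mulr1 big1 ?addr0// => v va.
by rewrite (negbTE va) mulr0.
Qed.

(** Redrawing one coordinate preserves the law. By [ffun_expand] it suffices to test indicators of
    points, for which both sides factor and agree coordinate by coordinate. *)
Lemma pexp_resample i (F : {ffun I -> V} -> R) :
  pexp mu F = pexp mu (fun w => \sum_v mu i v * F (upd w i v)).
Proof.
transitivity (pexp mu (fun w => \sum_t F t * \sum_v mu i v *
     \prod_j ((upd w i v j == t j)%:R : R))); last first.
  apply: eq_pexp => w; rewrite [RHS](eq_bigr (fun v => \sum_t mu i v * (F t *
     \prod_j ((upd w i v j == t j)%:R : R)))); last first.
    by move=> v _; rewrite [in LHS](ffun_expand F) mulr_sumr.
  rewrite exchange_big; apply: eq_bigr => t _.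
  by rewrite mulr_sumr; apply: eq_bigr => v _; rewrite mulrCA.
rewrite pexp_sum; apply: eq_bigr => t _.
rewrite pexpZ mulrC; congr (_ * _).
transitivity (\sum_v mu i v * ((v == t i)%:R * \prod_(j | j != i) mu j (t j))).
  rewrite [RHS](eq_bigr (fun v => mu i v * (v == t i)%:R * \prod_(j | j != i) mu j (t j)));
    last by move=> v _; rewrite mulrA.
  by rewrite -mulr_suml sum_indic /pmass (bigD1 i).
rewrite pexp_sum; apply: eq_bigr => v _; rewrite pexpZ; congr (_ * _).
transitivity (pexp mu (fun w => \prod_j (if j == i then (v == t i)%:R else (w j == t j)%:R)));
  last first.
  by apply: eq_pexp => w; apply: eq_bigr => j _; rewrite ffunE; case: eqP => // ->.
rewrite (pexp_prod (fun j x => if j == i then (v == t i)%:R else (x == t j)%:R)).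
rewrite [RHS](bigD1 i)//= eqxx -mulr_suml mu_sum1 mul1r; congr (_ * _).
by apply: eq_bigr => j /negbTE ->; rewrite sum_indic.
Qed.

Lemma pexp_indep i (F : {ffun I -> V} -> R) (g : V -> R) :
  (forall w v, F (upd w i v) = F w) ->
  pexp mu (fun w => F w * g (w i)) = pexp mu F * \sum_v mu i v * g v.
Proof.
move=> Fi; rewrite (pexp_resample i) mulrC -pexpZ; apply: eq_pexp => w.
rewrite mulr_suml; apply: eq_bigr => v _.
by rewrite Fi ffunE eqxx mulrAC mulrA.
Qed.

End FiniteProduct.

(** * Resampling each coordinate with probability one half *)

Definition splice_pmf {R : realFieldType} {I V : finType} (mu : I -> V -> R)
  (i : I) (z : bool * V) : R := mu i z.2 / 2.

Definition splice {I V : finType} (w : {ffun I -> V}) (z : {ffun I -> bool * V}) :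
  {ffun I -> V} := [ffun i => if (z i).1 then w i else (z i).2].

Lemma sum_bool_pair {R : realFieldType} {V : finType} (F : bool * V -> R) :
  \sum_z F z = \sum_v F (true, v) + \sum_v F (false, v).
Proof.
transitivity (\sum_(z : bool * V) F (z.1, z.2)).
  by apply: eq_bigr => -[].
by rewrite -(pair_bigA _ (fun b v => F (b, v))) big_bool.
Qed.

Lemma splice_pmf_is_pmf {R : realFieldType} {I V : finType} (mu : I -> V -> R) :
  is_pmf mu -> is_pmf (splice_pmf mu).
Proof.
move=> [mu0 mu1]; split=> [i z|i]; first by rewrite divr_ge0.
by rewrite sum_bool_pair /splice_pmf/= -mulr_suml mu1; lra.
Qed.

(** Coordinatewise, an even mixture of an old and a fresh value, both of law [mu i], has law [mu i]
    again; indicators of points reduce the claim to one coordinate. *)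
Lemma pexp_splice {R : realFieldType} {I V : finType} (mu : I -> V -> R)
    (F : {ffun I -> V} -> R) : is_pmf mu ->
  pexp mu (fun w => pexp (splice_pmf mu) (fun z => F (splice w z))) = pexp mu F.
Proof.
move=> mup; have nup := splice_pmf_is_pmf mup.
transitivity (\sum_t F t * pexp mu (fun w => pexp (splice_pmf mu) (fun z =>
    \prod_i ((splice w z i == t i)%:R : R)))).
  transitivity (pexp mu (fun w => \sum_t F t * pexp (splice_pmf mu) (fun z =>
    \prod_i ((splice w z i == t i)%:R : R)))); last first.
    by rewrite pexp_sum; apply: eq_bigr => t _; rewrite pexpZ.
  apply: eq_pexp => w.
  transitivity (pexp (splice_pmf mu) (fun z => \sum_t F t *
    \prod_i ((splice w z i == t i)%:R : R))).
    by apply: eq_pexp => z; exact: ffun_expand.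
  by rewrite pexp_sum; apply: eq_bigr => t _; rewrite pexpZ.
apply: eq_bigr => t _; rewrite mulrC; congr (_ * _).
(* Averaging the coin and the fresh value first leaves, for each coordinate, half an indicator at
   [w i] plus half the mass [mu i (t i)]. *)
transitivity (pexp mu (fun w => \prod_i ((w i == t i)%:R / 2 + mu i (t i) / 2))).
  apply: eq_pexp => w.
  transitivity (pexp (splice_pmf mu) (fun z => \prod_i (fun i y =>
      ((if y.1 then w i else y.2) == t i)%:R) i (z i))).
    by apply: eq_pexp => z; apply: eq_bigr => i _; rewrite ffunE.
  rewrite (pexp_prod (splice_pmf mu) (fun i y => ((if y.1 then w i else y.2) == t i)%:R)).
  apply: eq_bigr => i _.
  rewrite sum_bool_pair/= /splice_pmf/=; congr (_ + _).
    by rewrite -mulr_suml -mulr_suml mup.2 mul1r mulrC.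
  rewrite -[in RHS](sum_indic (mu i) (t i)) mulr_suml.
  by apply: eq_bigr => v _; rewrite mulrAC.
rewrite (pexp_prod mu (fun i v => (v == t i)%:R / 2 + mu i (t i) / 2)).
apply: eq_bigr => i _.
transitivity (\sum_v (mu i v * (v == t i)%:R / 2 + mu i v * (mu i (t i) / 2))).
  by apply: eq_bigr => v _ /=; rewrite [LHS]mulrDr [X in X + _]mulrA.
rewrite big_split/= -mulr_suml sum_indic -mulr_suml mup.2; lra.
Qed.

(** * Multilinear polynomials: orthogonality and fourth moments *)

Definition mono {R : realFieldType} {I V : finType} (x : I -> V -> R)
  (U : {set I}) (w : {ffun I -> V}) : R := \prod_(i in U) x i (w i).

Definition mpol {R : realFieldType} {I V : finType} (x : I -> V -> R)
  (h : {set I} -> R) (w : {ffun I -> V}) : R := \sum_(U : {set I}) h U * mono x U w.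

Section Multilinear.
Context {R : realFieldType} {I V : finType} (mu : I -> V -> R).
Hypothesis mu_pmf : is_pmf mu.

Local Notation m1 i g := (\sum_v mu i v * g v).

Lemma mono_upd (x : I -> V -> R) (U : {set I}) i w v :
  i \notin U -> mono x U (upd w i v) = mono x U w.
Proof.
move=> iU; apply: eq_bigr => j jU; rewrite ffunE; case: eqP => // ji.
by rewrite -ji jU in iU.
Qed.

(** If [U] and [W] differ, an index lying in exactly one of them contributes a centred factor, which
    kills the product. *)
Lemma pexp_mono2 (a b : I -> V -> R) (U W : {set I}) :
  (forall i, m1 i (a i) = 0) -> (forall i, m1 i (b i) = 0) ->
  pexp mu (fun w => mono a U w * mono b W w) =
  if U == W then \prod_(i in U) \sum_v mu i v * (a i v * b i v) else 0.
Proof.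
move=> a0 b0.
transitivity (pexp mu (fun w => \prod_i (fun i v => (if i \in U then a i v else 1) *
    (if i \in W then b i v else 1)) i (w i))).
  apply: eq_pexp => w; rewrite /mono big_mkcond [X in _ * X]big_mkcond/=.
  by rewrite -big_split.
rewrite (pexp_prod mu (fun i v => (if i \in U then a i v else 1) *
    (if i \in W then b i v else 1))).
case: eqP => [<-|/eqP UW].
  rewrite [RHS]big_mkcond; apply: eq_bigr => i _; case: ifP => // _.
  by rewrite -[RHS](mu_pmf.2 i); apply: eq_bigr => v _; rewrite !mulr1.
have [i iUW] : exists i, (i \in U) != (i \in W).
  by apply/existsP; rewrite -negb_forall; apply: contraNN UW => /forallP UW;
     apply/eqP/setP => i; apply/eqP.
rewrite (bigD1 i)//=; move: iUW; case: (i \in U); case: (i \in W) => // _.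
  by rewrite (eq_bigr (fun v => mu i v * a i v)) ?a0 ?mul0r// => v _; rewrite mulr1.
by rewrite (eq_bigr (fun v => mu i v * b i v)) ?b0 ?mul0r// => v _; rewrite mul1r.
Qed.

(** Two different families [a] and [b] are allowed because a polynomial will be paired with the one
    having the same coefficients in bounded variables. *)
Lemma pexp_mpol2 (a b : I -> V -> R) (h k : {set I} -> R) :
  (forall i, m1 i (a i) = 0) -> (forall i, m1 i (b i) = 0) ->
  pexp mu (fun w => mpol a h w * mpol b k w) =
  \sum_(U : {set I}) h U * k U * \prod_(i in U) \sum_v mu i v * (a i v * b i v).
Proof.
move=> a0 b0.
transitivity (pexp mu (fun w => \sum_U \sum_W (h U * k W) * (mono a U w * mono b W w))).
  apply: eq_pexp => w; rewrite mulr_suml; apply: eq_bigr => U _.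
  by rewrite mulr_sumr; apply: eq_bigr => W _; rewrite mulrACA.
rewrite pexp_sum; apply: eq_bigr => U _; rewrite pexp_sum.
rewrite (bigD1 U)//= [X in _ + X]big1 ?addr0.
  by rewrite pexpZ pexp_mono2// eqxx.
by move=> W WU; rewrite pexpZ pexp_mono2// eq_sym (negbTE WU) mulr0.
Qed.

Lemma sum_subset_split (i : I) (D : {set I}) (g : {set I} -> R) : i \in D ->
  \sum_(U : {set I} | U \subset D) g U =
  \sum_(U : {set I} | U \subset D :\ i) g U +
  \sum_(U : {set I} | U \subset D :\ i) g (i |: U).
Proof.
move=> iD; rewrite (bigID (fun U : {set I} => i \in U))/= addrC; congr (_ + _).
  by apply: eq_bigl => U; rewrite subsetD1.
rewrite (reindex_onto (fun U => i |: U) (fun U => U :\ i))/=; last first.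
  by move=> U /andP[_ iU]; rewrite finset.setD1K.
apply: eq_bigl => U; rewrite finset.subUset finset.sub1set iD/= finset.setU11 andbT subsetD1.
case iU: (i \in U).
  rewrite andbF; apply/negbTE; rewrite negb_and; apply/orP; right.
  by apply/eqP => H; move: iU; rewrite -H finset.setD11.
by rewrite finset.setU1K ?iU// eqxx andbT.
Qed.

Lemma quad_ge0_discr (x y z : R) :
  0 <= z -> (forall l, 0 <= x - 2 * l * y + l ^+ 2 * z) -> y ^+ 2 <= x * z.
Proof.
move=> z0 H; have [z1|z1] := eqVneq z 0.
  have [->|y0] := eqVneq y 0; first by rewrite z1 expr0n mulr0.
  (* When [z = 0] and [y != 0] the expression is affine in [l]; this [l] gives it the value -1. *)
  have := H ((x + 1) / (2 * y)); rewrite z1 mulr0 addr0.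
  have -> : 2 * ((x + 1) / (2 * y)) * y = x + 1 by field.
  lra.
have zp : 0 < z by rewrite lt_neqAle eq_sym z1.
have := H (y / z).
have -> : x - 2 * (y / z) * y + (y / z) ^+ 2 * z = (x * z - y ^+ 2) / z by field.
by rewrite pmulr_lge0 ?invr_gt0// subr_ge0.
Qed.

Lemma pexp_cauchy_schwarz (F G : {ffun I -> V} -> R) :
  pexp mu (fun w => F w * G w) ^+ 2 <=
  pexp mu (fun w => F w ^+ 2) * pexp mu (fun w => G w ^+ 2).
Proof.
apply: quad_ge0_discr => [|l]; first by apply: pexp_ge0 => // w; exact: sqr_ge0.
rewrite -mulNr -!pexpZ -!pexpD.
apply: pexp_ge0 => // w; rewrite -[leRHS]/(F w ^+ 2 + - (2 * l) * (F w * G w) + l ^+ 2 * G w ^+ 2).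
by have := sqr_ge0 (F w - l * G w); congr (_ <= _); ring.
Qed.

(* Bonami's lemma without symmetry: the third moment is absorbed by
   [4 a b^3 m3 <= 2 a^2 b^2 m2 + 2 b^4 m4]. *)
Lemma pexp_pow4_subset (phi : I -> V -> R) (t : I -> R) (B : R) (h : {set I} -> R)
    (D : {set I}) :
  1 <= B -> (forall i, 0 <= t i) ->
  (forall i, m1 i (phi i) = 0) ->
  (forall i, \sum_v mu i v * phi i v ^+ 2 <= B * t i) ->
  (forall i, \sum_v mu i v * phi i v ^+ 4 <= B * t i ^+ 2) ->
  pexp mu (fun w => (\sum_(U : {set I} | U \subset D) h U * mono phi U w) ^+ 4) <=
  (\sum_(U : {set I} | U \subset D) h U ^+ 2 * \prod_(i in U) (4 * B * t i)) ^+ 2.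
Proof.
move=> B1 t0 phi0 phi2 phi4.
(* Induction on the size of [D]: singling out [i] in [D], the polynomial is [A + Bw * phi i] with
   [A] and [Bw] independent of coordinate [i]. *)
move Dn : #|D| => n; elim: n D Dn h => [|n IH] D Dn h.
  move/eqP: Dn; rewrite cards_eq0 => /eqP ->.
  have sub0 (F : {set I} -> R) : \sum_(U : {set I} | U \subset finset.set0) F U = F finset.set0.
    by rewrite (big_pred1 finset.set0)// => U; rewrite finset.subset0.
  rewrite sub0 big_set0 mulr1 -exprM -[leRHS](pexp_cst mu_pmf).
  by apply: le_pexp => // w; rewrite sub0 /mono big_set0 mulr1.
have [i iD] : exists i, i \in D by apply/set0Pn; rewrite -card_gt0 Dn.
have Di : #|D :\ i| = n by move: Dn; rewrite (cardsD1 i) iD => -[].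
set D' := D :\ i in Di *.
pose A w := \sum_(U : {set I} | U \subset D') h U * mono phi U w.
pose Bw w := \sum_(U : {set I} | U \subset D') h (i |: U) * mono phi U w.
pose a := \sum_(U : {set I} | U \subset D') h U ^+ 2 * \prod_(i in U) (4 * B * t i).
pose b := \sum_(U : {set I} | U \subset D') h (i |: U) ^+ 2 * \prod_(i in U) (4 * B * t i).
have iU (U : {set I}) : U \subset D' -> i \notin U by rewrite subsetD1 => /andP[].
have Aupd w v : A (upd w i v) = A w.
  by apply: eq_bigr => U /iU iU'; rewrite mono_upd.
have Bupd w v : Bw (upd w i v) = Bw w.
  by apply: eq_bigr => U /iU iU'; rewrite mono_upd.
have tB0 j : 0 <= 4 * B * t j by rewrite !mulr_ge0 ?t0//; lra.
have a0 : 0 <= a.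
  by apply: sumr_ge0 => U _; rewrite mulr_ge0 ?sqr_ge0 ?prodr_ge0.
have b0 : 0 <= b.
  by apply: sumr_ge0 => U _; rewrite mulr_ge0 ?sqr_ge0 ?prodr_ge0.
have A4 : pexp mu (fun w => A w ^+ 4) <= a ^+ 2 by exact: IH.
have B4 : pexp mu (fun w => Bw w ^+ 4) <= b ^+ 2 by exact: IH.
have -> : \sum_(U : {set I} | U \subset D) h U ^+ 2 * \prod_(i in U) (4 * B * t i)
   = a + 4 * B * t i * b.
  rewrite (sum_subset_split _ iD) -/D'; congr (_ + _).
  rewrite mulr_sumr; apply: eq_bigr => U /iU iU'.
  by rewrite big_setU1//= mulrCA.
have AB w : \sum_(U : {set I} | U \subset D) h U * mono phi U w = A w + Bw w * phi i (w i).
  rewrite (sum_subset_split _ iD) -/D'; congr (_ + _).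
  rewrite mulr_suml; apply: eq_bigr => U /iU iU'.
  by rewrite /mono big_setU1//= mulrCA mulrC.
have pw w : (\sum_(U : {set I} | U \subset D) h U * mono phi U w) ^+ 4 <=
    A w ^+ 4 + (4 * (A w ^+ 3 * Bw w)) * phi i (w i) +
    (8 * (A w ^+ 2 * Bw w ^+ 2)) * phi i (w i) ^+ 2 + (3 * Bw w ^+ 4) * phi i (w i) ^+ 4.
  rewrite AB; set x := A w; set y := Bw w; set p := phi i (w i).
  have : 0 <= 2 * (x * y * p - y ^+ 2 * p ^+ 2) ^+ 2 by rewrite mulr_ge0 ?sqr_ge0.
  rewrite -subr_ge0 => H; rewrite -subr_ge0; apply: le_trans H _.
  by rewrite le_eqVlt; apply/orP; left; apply/eqP; ring.
apply: le_trans (le_pexp mu_pmf pw) _.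
rewrite 3!pexpD.
rewrite (pexp_indep mu_pmf (F := fun w => 4 * (A w ^+ 3 * Bw w)) (phi i)); last first.
  by move=> w v; rewrite Aupd Bupd.
rewrite (pexp_indep mu_pmf (F := fun w => 8 * (A w ^+ 2 * Bw w ^+ 2))
  (fun v => phi i v ^+ 2)); last by move=> w v; rewrite Aupd Bupd.
rewrite (pexp_indep mu_pmf (F := fun w => 3 * Bw w ^+ 4)
  (fun v => phi i v ^+ 4)); last by move=> w v; rewrite Bupd.
rewrite phi0 mulr0 addr0 !pexpZ.
have ABab : pexp mu (fun w => A w ^+ 2 * Bw w ^+ 2) <= a * b.
  rewrite -ler_sqr ?nnegrE ?mulr_ge0//; last first.
    by apply: pexp_ge0 => // w; rewrite mulr_ge0 ?sqr_ge0.
  apply: le_trans (pexp_cauchy_schwarz _ _) _; rewrite exprMn.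
  apply: ler_pM.
  - by apply: pexp_ge0 => // w; exact: sqr_ge0.
  - by apply: pexp_ge0 => // w; exact: sqr_ge0.
  - by apply: le_trans A4; apply: le_pexp => // w; rewrite -exprM.
  - by apply: le_trans B4; apply: le_pexp => // w; rewrite -exprM.
have p2 : 0 <= \sum_v mu i v * phi i v ^+ 2.
  by apply: sumr_ge0 => v _; rewrite mulr_ge0 ?sqr_ge0 ?mu_pmf.1.
have p4 : 0 <= \sum_v mu i v * phi i v ^+ 4.
  by apply: sumr_ge0 => v _; rewrite mulr_ge0 ?exprn_even_ge0 ?mu_pmf.1.
have AB0 : 0 <= pexp mu (fun w => A w ^+ 2 * Bw w ^+ 2).
  by apply: pexp_ge0 => // w; rewrite mulr_ge0 ?sqr_ge0.
have BB0 : 0 <= pexp mu (fun w => Bw w ^+ 4).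
  by apply: pexp_ge0 => // w; rewrite exprn_even_ge0.
have H1 := ler_pM AB0 p2 ABab (phi2 i).
have H2 := ler_pM BB0 p4 B4 (phi4 i).
(* Here [1 <= B] enters, through [3 * B <= 16 * B ^ 2]. *)
have H3 : 3 * (b ^+ 2 * (B * t i ^+ 2)) <= (4 * B * t i * b) ^+ 2.
  have -> : (4 * B * t i * b) ^+ 2 = (16 * B ^+ 2) * (b ^+ 2 * t i ^+ 2) by ring.
  have -> : 3 * (b ^+ 2 * (B * t i ^+ 2)) = (3 * B) * (b ^+ 2 * t i ^+ 2) by ring.
  rewrite ler_wpM2r ?mulr_ge0 ?sqr_ge0//.
  have : 0 <= (B - 1) * B by rewrite mulr_ge0; lra.
  nra.
(* The factor 4 in the weights makes the cross term of this square equal to the bound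
   [8 * (a * b * (B * t i))] coming from [H1]. *)
have -> : (a + 4 * B * t i * b) ^+ 2 = a ^+ 2 + 8 * (a * b * (B * t i)) +
  (4 * B * t i * b) ^+ 2 by ring.
rewrite -[8 * _ * _]mulrA -[3 * _ * _]mulrA; lra.
Qed.

Lemma pexp_pow4 (phi : I -> V -> R) (t : I -> R) (B : R) (h : {set I} -> R) :
  1 <= B -> (forall i, 0 <= t i) ->
  (forall i, m1 i (phi i) = 0) ->
  (forall i, \sum_v mu i v * phi i v ^+ 2 <= B * t i) ->
  (forall i, \sum_v mu i v * phi i v ^+ 4 <= B * t i ^+ 2) ->
  pexp mu (fun w => mpol phi h w ^+ 4) <=
  (\sum_(U : {set I}) h U ^+ 2 * \prod_(i in U) (4 * B * t i)) ^+ 2.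
Proof.
move=> B1 t0 phi0 phi2 phi4.
have subT (F : {set I} -> R) : \sum_(U : {set I} | U \subset finset.setT) F U = \sum_U F U.
  by apply: eq_bigl => U; rewrite finset.subsetT.
have := pexp_pow4_subset h finset.setT B1 t0 phi0 phi2 phi4.
by rewrite subT; congr (_ <= _); apply: eq_pexp => w; rewrite subT.
Qed.

End Multilinear.

(** * The maximal inequality on finite product spaces *)

Ltac nneg := repeat first [assumption | by apply: ltW | exact: sqr_ge0
  | exact: exprn_even_ge0 | apply: addr_ge0 | apply: mulr_ge0 | rewrite invr_ge0 | lra].

Definition ppr {R : realFieldType} {I V : finType} (mu : I -> V -> R)
  (A : pred {ffun I -> V}) : R := pexp mu (fun w => (A w)%:R).

(** The pairing of [W] with [Z] is at least [kap * s]. Where [|W| <= eps] it is controlled by [eps];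
    the rare set where [|W| > eps] contributes little. The fourth moment is asked of the test
    function [Z] only, since the intended [W] has no uniform fourth moment bound. *)
Lemma second_moment_le {R : realFieldType} (beta gam kap : R) :
  0 <= beta -> 0 <= gam -> 0 < kap -> exists C eta : R, [/\ 0 < C, 0 < eta &
  forall (I V : finType) (mu : I -> V -> R) (W Z : {ffun I -> V} -> R) (s eps : R),
    is_pmf mu -> 0 <= s ->
    pexp mu (fun w => W w ^+ 2) <= s ->
    pexp mu (fun w => Z w ^+ 2) <= beta * s ->
    pexp mu (fun w => Z w ^+ 4) <= gam * s ^+ 2 ->
    kap * s <= pexp mu (fun w => W w * Z w) ->
    ppr mu (fun w => eps < `|W w|) <= eta ->
    s <= C * eps ^+ 2].
Proof.
move=> beta0 gam0 kap0.
(* These constants, together with [eta] below, make each of four error terms at most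
   [s ^ 2 * (kap / 8)], so half of [kap * s ^ 2] survives. *)
pose a := kap / (8 * (beta + 1)); pose a' := kap / 8.
pose c := kap * a' / (8 * (gam + 1)).
have a0 : 0 < a by rewrite divr_gt0//; lra.
have a'0 : 0 < a' by rewrite divr_gt0//; lra.
have c0 : 0 < c by rewrite divr_gt0 ?mulr_gt0//; lra.
have aE : a = kap / (8 * (beta + 1)) by [].
have a'E : a' = kap / 8 by [].
have cE : c = kap * a' / (8 * (gam + 1)) by [].
clearbody a a' c.
exists (2 / (kap * a)), (kap * (c * a') / 8).
split; first by apply: divr_gt0; [lra|exact: mulr_gt0].
  apply: divr_gt0; last by lra.
  by apply: mulr_gt0 => //; exact: mulr_gt0.
move=> I V mu W Z s eps mup s0 W2 Z2 Z4 WZ prA.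
set A := fun w => eps < `|W w| in prA.
have amgm (k x y : R) : 0 < k -> x * y <= k * y ^+ 2 + x ^+ 2 / k.
  move=> k0; rewrite -subr_ge0.
  have -> : k * y ^+ 2 + x ^+ 2 / k - x * y =
    ((k * y - x / 2) ^+ 2 + 3 / 4 * x ^+ 2) / k by field; lra.
  by rewrite divr_ge0 ?(ltW k0)// addr_ge0 ?sqr_ge0// mulr_ge0 ?sqr_ge0.
(* Off [A] one application of [amgm] suffices; on [A] a second one trades [Z ^ 2] for [Z ^ 4] and
   the indicator. The common factor [s] avoids a division by [s], which may be zero. *)
have pw w : s * (W w * Z w) <= (s * a) * Z w ^+ 2 + s * eps ^+ 2 / a +
    ((s * a') * W w ^+ 2 + ((c / a') * Z w ^+ 4 + (s ^+ 2 / (c * a')) * (A w)%:R)).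
  have [Aw|Aw] := boolP (A w).
    have H1 : s * (W w * Z w) <= s * (a' * W w ^+ 2 + Z w ^+ 2 / a').
      by rewrite ler_wpM2l// [W w * _]mulrC; exact: amgm.
    have H2 : s * Z w ^+ 2 / a' <= (c * Z w ^+ 4 + s ^+ 2 / c) / a'.
      rewrite ler_pM2r ?invr_gt0//.
      by have := amgm c s (Z w ^+ 2) c0; rewrite -exprM.
    have H3 : 0 <= s * a * Z w ^+ 2 + s * eps ^+ 2 / a.
      by nneg.
    rewrite mulr1; have -> : s ^+ 2 / (c * a') = s ^+ 2 / c / a' by field; lra.
    lra.
  have We : W w ^+ 2 <= eps ^+ 2.
    rewrite /A -leNgt in Aw.
    by rewrite -real_normK ?num_real// ler_pXn2r// nnegrE (le_trans _ Aw).
  have H1 : s * (W w * Z w) <= s * (a * Z w ^+ 2 + W w ^+ 2 / a).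
    by rewrite ler_wpM2l//; exact: amgm.
  have H2 : s * (W w ^+ 2 / a) <= s * (eps ^+ 2 / a).
    by rewrite ler_wpM2l// ler_pM2r ?invr_gt0.
  have H3 : 0 <= s * a' * W w ^+ 2 + (c / a') * Z w ^+ 4.
    by nneg.
  rewrite mulr0; lra.
have := le_pexp mup pw; rewrite !pexpD !pexpZ pexp_cst// -/(ppr mu A) => H.
have H1 : s * (kap * s) <= s * pexp mu (fun w => W w * Z w) by rewrite ler_wpM2l.
have H2 : s * a * pexp mu (fun w => Z w ^+ 2) <= s * a * (beta * s).
  by apply: ler_wpM2l => //; nneg.
have H3 : s * a' * pexp mu (fun w => W w ^+ 2) <= s * a' * s.
  by apply: ler_wpM2l => //; nneg.
have H4 : c / a' * pexp mu (fun w => Z w ^+ 4) <= c / a' * (gam * s ^+ 2).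
  by apply: ler_wpM2l => //; nneg.
have H5 : s ^+ 2 / (c * a') * ppr mu A <= s ^+ 2 / (c * a') * (kap * (c * a') / 8).
  by apply: ler_wpM2l => //; nneg.
have E5 : s ^+ 2 / (c * a') * (kap * (c * a') / 8) = s ^+ 2 * (kap / 8).
  by field; lra.
have E4 : c / a' * (gam * s ^+ 2) <= s ^+ 2 * (kap / 8).
  have -> : c / a' * (gam * s ^+ 2) = s ^+ 2 * (kap / 8) * (gam / (gam + 1)).
    by rewrite cE; field; lra.
  rewrite -[leRHS]mulr1; apply: ler_wpM2l; first by nneg.
  by rewrite ler_pdivrMr; lra.
have E2 : s * a * (beta * s) <= s ^+ 2 * (kap / 8).
  have -> : s * a * (beta * s) = s ^+ 2 * (kap / 8) * (beta / (beta + 1)).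
    by rewrite aE; field; lra.
  rewrite -[leRHS]mulr1; apply: ler_wpM2l; first by nneg.
  by rewrite ler_pdivrMr; lra.
have E3 : s * a' * s = s ^+ 2 * (kap / 8) by rewrite a'E; ring.
have F : s * (kap / 2 * s) <= s * (eps ^+ 2 / a).
  have -> : s * (kap / 2 * s) = s ^+ 2 * (kap / 2) by ring.
  have -> : s * (eps ^+ 2 / a) = s * eps ^+ 2 / a by rewrite mulrA.
  have X : s * (kap * s) = s ^+ 2 * kap by ring.
  lra.
have [s1|s1] := eqVneq s 0.
  by rewrite s1; nneg.
have sp : 0 < s by rewrite lt_neqAle eq_sym s1.
rewrite ler_pM2l// in F.
have -> : 2 / (kap * a) * eps ^+ 2 = (eps ^+ 2 / a) / (kap / 2) by field; lra.
by rewrite ler_pdivlMr ?divr_gt0// mulrC.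
Qed.

Lemma ppr_le {R : realFieldType} {I V : finType} (mu : I -> V -> R) (A B : pred {ffun I -> V}) :
  is_pmf mu -> (forall w, A w -> B w) -> ppr mu A <= ppr mu B.
Proof.
move=> mup AB; apply: le_pexp => // w.
by case Aw: (A w); [rewrite (AB _ Aw)|rewrite ler0n].
Qed.

Lemma mean_le {R : realFieldType} {V : finType} (nu : V -> R) (g : V -> R) c :
  (forall v, 0 <= nu v) -> \sum_v nu v = 1 -> (forall v, g v <= c) ->
  \sum_v nu v * g v <= c.
Proof.
move=> nu0 nu1 gc; rewrite -[leRHS]mul1r -nu1 mulr_suml.
by apply: ler_sum => v _; rewrite ler_wpM2l.
Qed.

(** A constant attached to every variable costs at most its [q]-th power, because sets of more than
    [q] elements carry no coefficient. *)
Lemma weight_le {R : realFieldType} {I : finType} (q : nat) (g : {set I} -> R) (t : I -> R) c :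
  1 <= c -> (forall i, 0 <= t i) -> (forall U : {set I}, (q < #|U|)%N -> g U = 0) ->
  \sum_(U : {set I}) g U ^+ 2 * \prod_(i in U) (c * t i) <=
  c ^+ q * \sum_(U : {set I}) g U ^+ 2 * \prod_(i in U) t i.
Proof.
move=> c1 t0 gq; rewrite mulr_sumr; apply: ler_sum => U _.
have [/gq ->|Uq] := ltnP q #|U|; first by rewrite expr0n/= !mul0r mulr0.
rewrite mulrCA; apply: ler_wpM2l; first exact: sqr_ge0.
rewrite big_split/= prodr_const ler_wpM2r ?prodr_ge0//.
exact: ler_weXn2l.
Qed.

Lemma weight_ge {R : realFieldType} {I : finType} (q : nat) (g : {set I} -> R) (t : I -> R) c :
  0 <= c <= 1 -> (forall i, 0 <= t i) -> (forall U : {set I}, (q < #|U|)%N -> g U = 0) ->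
  c ^+ q * \sum_(U : {set I}) g U ^+ 2 * \prod_(i in U) t i <=
  \sum_(U : {set I}) g U ^+ 2 * \prod_(i in U) (c * t i).
Proof.
move=> /andP[c0 c1] t0 gq; rewrite mulr_sumr; apply: ler_sum => U _.
have [/gq ->|Uq] := ltnP q #|U|; first by rewrite expr0n/= !mul0r mulr0.
rewrite mulrCA; apply: ler_wpM2l; first exact: sqr_ge0.
rewrite big_split/= prodr_const ler_wpM2r ?prodr_ge0//.
exact: ler_wiXn2l.
Qed.

(** Each product over [U] of [m i + e i] is expanded over the set [J] of factors where [e i] is
    picked. The inner product vanishes unless [J] is contained in [U], and is then the product of
    [m] over the rest of [U]. *)
Lemma mpol_shift {R : realFieldType} {I V V' : finType} (x : I -> V -> R) (m : I -> R)
    (e : I -> V' -> R) (h : {set I} -> R) (w : {ffun I -> V}) (z : {ffun I -> V'}) :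
  (forall i, x i (w i) = m i + e i (z i)) ->
  mpol x h w = mpol e (fun J : {set I} => \sum_(U : {set I}) h U *
    \prod_i (if i \in J then (i \in U)%:R else if i \in U then m i else 1)) z.
Proof.
move=> xe; transitivity (\sum_(U : {set I}) \sum_(J : {set I}) h U *
    \prod_i (if i \in J then (i \in U)%:R else if i \in U then m i else 1) * mono e J z).
  apply: eq_bigr => U _.
  transitivity (h U * \prod_i ((i \in U)%:R * e i (z i) + (if i \in U then m i else 1))).
    congr (_ * _); rewrite /mono big_mkcond; apply: eq_bigr => i _.
    by case: (i \in U); rewrite ?mul1r ?mul0r ?add0r// xe addrC.
  rewrite bigA_distr mulr_sumr; apply: eq_bigr => J _.
  rewrite -mulrA; congr (_ * _); rewrite /mono [X in _ * X]big_mkcond -big_split/=.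
  by apply: eq_bigr => i _; case: ifP => // _; rewrite mulr1.
rewrite exchange_big; apply: eq_bigr => J _.
by rewrite -mulr_suml.
Qed.

Definition halve {R : realFieldType} {I : finType} (h : {set I} -> R) (U : {set I}) : R :=
  h U * 2^-1 ^+ #|U|.

(* Given [w], the polynomial evaluated at the spliced point [z] has mean the halved
   polynomial at [w]; if it is small with high probability, so is its second moment
   and hence its mean. The dual family [phi] is bounded after normalisation by [t],
   uniformly in the value of [x i (w i)]. *)
Lemma halve_le {R : realFieldType} (q : nat) (K kap : R) : 1 <= K -> 0 < kap <= 1 ->
  exists C eta : R, [/\ 0 < C, 0 < eta &
  forall (I V : finType) (mu x psi : I -> V -> R),
    is_pmf mu ->
    (forall i, \sum_v mu i v * x i v = 0) ->
    (forall i, \sum_v mu i v * x i v ^+ 2 <= 4) ->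
    (forall i, \sum_v mu i v * psi i v = 0) ->
    (forall i v, `|psi i v| <= K) ->
    (forall i, kap <= \sum_v mu i v * (x i v * psi i v)) ->
  forall (h : {set I} -> R) (eps : R) (w : {ffun I -> V}),
    (forall U : {set I}, (q < #|U|)%N -> h U = 0) -> 0 <= eps ->
    ppr (splice_pmf mu) (fun z => eps < `|mpol x h (splice w z)|) <= eta ->
    `|mpol x (halve h) w| <= C * eps].
Proof.
move=> K1 /andP[kap0 kap1].
(* From [phi ^ 2 <= 2 * K ^ 2 * t], proved below, the fourth power is at most
   [4 * K ^ 4 * t ^ 2]. *)
pose B := 4 * K ^+ 4.
have B1 : 1 <= B.
  have : 1 <= K ^+ 4 by exact: exprn_ege1.
  rewrite /B; lra.
have KB : 2 * K ^+ 2 <= B.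
  have : K ^+ 2 <= K ^+ 4 by exact: ler_weXn2l.
  have : 0 <= K ^+ 2 by exact: sqr_ge0.
  rewrite /B; lra.
have Bq0 : 0 <= B ^+ q by apply: exprn_ge0; lra.
have Bq1 : 0 <= ((4 * B) ^+ q) ^+ 2 by exact: sqr_ge0.
have kq0 : 0 < (kap / 4) ^+ q by apply: exprn_gt0; lra.
have [C [eta [C0 eta0 H]]] := second_moment_le Bq0 Bq1 kq0.
(* Instead of a square root of [C]: the end of the proof only needs [C <= (C + 1) ^ 2]. *)
exists (C + 1), eta; split => //; first by lra.
move=> I V mu x psi mup x0 x2 psi0 psiK xpsi h eps w hq eps0 prW.
pose nu := splice_pmf mu; have nup : is_pmf nu by exact: splice_pmf_is_pmf.
pose y i := x i (w i).
(* [e] is the spliced variable minus its conditional mean [y i / 2]. [phi] agrees with [e] when the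
   old value is kept and replaces the fresh [x] by the bounded [psi] otherwise, so both are
   centred. *)
pose e i (z : bool * V) := (if z.1 then y i else x i z.2) - y i / 2.
pose phi i (z : bool * V) := if z.1 then y i / 2 else psi i z.2 - y i / 2.
(* An upper bound for the variance of [e i]: the summand 2 is half of the bound 4 on the second
   moment of [x i]. *)
pose t i := (y i / 2) ^+ 2 + 2.
have t2 i : 2 <= t i by rewrite /t; have := sqr_ge0 (y i / 2); lra.
have t0 i : 0 <= t i by apply: le_trans (t2 i); lra.
pose g (J : {set I}) := \sum_(U : {set I}) h U *
    \prod_i (if i \in J then (i \in U)%:R else if i \in U then y i / 2 else 1).
have gq (J : {set I}) : (q < #|J|)%N -> g J = 0.
  move=> qJ; apply: big1 => U _; have [/hq ->|Uq] := ltnP q #|U|; first by rewrite mul0r.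
  have [i iJ iU] : exists2 i, i \in J & i \notin U.
    apply/fintype.subsetPn; apply/negP => /subset_leq_card JU.
    by move: (leq_trans qJ (leq_trans JU Uq)); rewrite ltnn.
  by rewrite (bigD1 i)//= iJ (negbTE iU) mul0r mulr0.
have Wg z : mpol x h (splice w z) = mpol e g z.
  by apply: mpol_shift => i; rewrite /e ffunE [RHS]addrC subrK; case: ifP.
(* For empty [J] every index of [U] contributes [y i / 2], so the constant coefficient is the halved
   polynomial at [w]. *)
have g0 : g finset.set0 = mpol x (halve h) w.
  apply: eq_bigr => U _; rewrite /halve -mulrA; congr (_ * _).
  rewrite -prodr_const /mono -big_split/= [RHS]big_mkcond; apply: eq_bigr => i _.
  by rewrite finset.in_set0; case: ifP => // _; rewrite mulrC.
pose s := \sum_(J : {set I}) g J ^+ 2 * \prod_(i in J) t i.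
have s0 : 0 <= s by apply: sumr_ge0 => J _; rewrite mulr_ge0 ?sqr_ge0 ?prodr_ge0.
have mean_nu i (f : bool * V -> R) : \sum_z nu i z * f z =
    2^-1 * \sum_v mu i v * f (true, v) + 2^-1 * \sum_v mu i v * f (false, v).
  rewrite sum_bool_pair /nu /splice_pmf/= !mulr_sumr; congr (_ + _);
    by apply: eq_bigr => v _; ring.
have meanc i c : \sum_v mu i v * c = c by rewrite -mulr_suml mup.2 mul1r.
have e0 i : \sum_z nu i z * e i z = 0.
  rewrite mean_nu /e/= meanc.
  transitivity (2^-1 * (y i - y i / 2) + 2^-1 * (\sum_v mu i v * x i v - \sum_v mu i v * (y i / 2))).
    by rewrite -sumrB; congr (_ + _ * _); apply: eq_bigr => v _; rewrite mulrBr.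
  by rewrite meanc x0; lra.
have phi0 i : \sum_z nu i z * phi i z = 0.
  rewrite mean_nu /phi/= meanc.
  transitivity (2^-1 * (y i / 2) + 2^-1 * (\sum_v mu i v * psi i v - \sum_v mu i v * (y i / 2))).
    by rewrite -sumrB; congr (_ + _ * _); apply: eq_bigr => v _; rewrite mulrBr.
  by rewrite meanc psi0; lra.
have e2 i : \sum_z nu i z * (e i z * e i z) <= t i.
  rewrite mean_nu /e/= meanc.
  have -> : \sum_v mu i v * ((x i v - y i / 2) * (x i v - y i / 2)) =
     \sum_v mu i v * x i v ^+ 2 - y i * (\sum_v mu i v * x i v) + (y i / 2) ^+ 2.
    rewrite -[X in _ = _ + X](meanc i) mulr_sumr -sumrB -big_split/=.
    by apply: eq_bigr => v _; field.
  rewrite x0 mulr0 subr0 /t; have := x2 i; lra.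
have ephi i : kap / 4 * t i <= \sum_z nu i z * (e i z * phi i z).
  rewrite mean_nu /e /phi/= meanc.
  have -> : \sum_v mu i v * ((x i v - y i / 2) * (psi i v - y i / 2)) =
     \sum_v mu i v * (x i v * psi i v) - y i / 2 * (\sum_v mu i v * x i v)
      - y i / 2 * (\sum_v mu i v * psi i v) + (y i / 2) ^+ 2.
    rewrite -[X in _ = _ + X](meanc i) !mulr_sumr -!sumrB -big_split/=.
    by apply: eq_bigr => v _; field.
  rewrite x0 psi0 !mulr0 !subr0 /t.
  have : kap * (y i / 2) ^+ 2 <= (y i / 2) ^+ 2.
    by rewrite -[leRHS]mul1r ler_wpM2r ?sqr_ge0.
  have := sqr_ge0 (y i / 2); have := xpsi i; lra.
have phi_le i z : phi i z ^+ 2 <= 2 * K ^+ 2 * t i.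
  have psi2 v : psi i v ^+ 2 <= K ^+ 2.
    by rewrite -real_normK ?num_real// ler_pXn2r ?nnegrE//; lra.
  have KK : 1 <= K ^+ 2 by exact: exprn_ege1.
  have Y := sqr_ge0 (y i / 2).
  have KY : (y i / 2) ^+ 2 <= K ^+ 2 * (y i / 2) ^+ 2 by rewrite -[leLHS]mul1r ler_wpM2r.
  rewrite /phi; case: z => -[] v /=; rewrite /t; first by lra.
  have := psi2 v; have := sqr_ge0 (psi i v + y i / 2); lra.
have phi2 i : \sum_z nu i z * phi i z ^+ 2 <= B * t i.
  apply: mean_le; [exact: nup.1|exact: nup.2|move=> z].
  by apply: le_trans (phi_le i z) _; rewrite ler_wpM2r.
have phi4 i : \sum_z nu i z * phi i z ^+ 4 <= B * t i ^+ 2.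
  apply: mean_le; [exact: nup.1|exact: nup.2|move=> z].
  have -> : B * t i ^+ 2 = (2 * K ^+ 2 * t i) ^+ 2 by rewrite /B; ring.
  rewrite (exprM _ 2 2) ler_pXn2r ?nnegrE ?sqr_ge0//.
  by rewrite mulr_ge0// mulr_ge0 ?sqr_ge0.
have sC : s <= C * eps ^+ 2.
  apply: (H _ _ nu (mpol e g) (mpol phi g)) => //.
  - under eq_pexp do rewrite expr2.
    rewrite pexp_mpol2//; apply: ler_sum => J _; rewrite -expr2.
    apply: ler_wpM2l; first exact: sqr_ge0.
    apply: ler_prod => i _; rewrite e2 andbT; apply: sumr_ge0 => z _.
    by rewrite mulr_ge0 ?nup.1// -expr2 sqr_ge0.
  - under eq_pexp do rewrite expr2.
    rewrite pexp_mpol2//; apply: le_trans (weight_le B1 t0 gq).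
    apply: ler_sum => J _; rewrite -expr2.
    apply: ler_wpM2l; first exact: sqr_ge0.
    apply: ler_prod => i _; apply/andP; split; last first.
      by apply: le_trans (phi2 i); rewrite le_eqVlt; apply/orP; left; apply/eqP.
    apply: sumr_ge0 => z _.
    by rewrite mulr_ge0 ?nup.1// -expr2 sqr_ge0.
  - apply: le_trans (pexp_pow4 nup g B1 t0 phi0 phi2 phi4) _.
    rewrite -exprMn ler_pXn2r ?nnegrE//.
    + by apply: weight_le => //; lra.
    + apply: sumr_ge0 => J _; rewrite mulr_ge0 ?sqr_ge0 ?prodr_ge0// => i _.
      by rewrite mulr_ge0//; lra.
    + by rewrite mulr_ge0// exprn_ge0//; lra.
  - rewrite pexp_mpol2//; apply: le_trans (weight_ge _ t0 gq) _; first by apply/andP; split; lra.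
    apply: ler_sum => J _; rewrite -expr2.
    apply: ler_wpM2l; first exact: sqr_ge0.
    apply: ler_prod => i _; rewrite ephi andbT.
    by rewrite mulr_ge0//; lra.
  - by apply: le_trans prW; apply: ppr_le => // z; rewrite Wg.
rewrite -g0 -ler_sqr ?nnegrE//; last by rewrite mulr_ge0//; lra.
rewrite real_normK ?num_real//.
(* The squared constant coefficient is one of the nonnegative terms of [s]. *)
have : g finset.set0 ^+ 2 <= s.
  rewrite /s (bigD1 finset.set0)//= big_set0 mulr1 lerDl.
  by apply: sumr_ge0 => J _; rewrite mulr_ge0 ?sqr_ge0 ?prodr_ge0.
move=> /le_trans -/(_ _ sC) /le_trans; apply.
rewrite exprMn ler_wpM2r ?sqr_ge0//; have := sqr_ge0 C; lra.
Qed.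

(** The second moment is allowed up to 4 rather than 1 because discretisation preserves variances
    only approximately. The bounded centred [psi] correlated with [x] stands in for missing higher
    moments. *)
Definition admissible {R : realFieldType} (K kap : R) {I V : finType} (mu x : I -> V -> R) :=
  [/\ is_pmf mu,
      forall i, \sum_v mu i v * x i v = 0,
      forall i, \sum_v mu i v * x i v ^+ 2 <= 4 &
      exists psi : I -> V -> R, [/\ forall i, \sum_v mu i v * psi i v = 0,
        forall i v, `|psi i v| <= K &
        forall i, kap <= \sum_v mu i v * (x i v * psi i v)]].

(** By [halve_le], wherever some halved polynomial exceeds [C * eps], the conditional probability
    [G w] of the original event is at least [eta]. Averaging over [w] is Markov's inequality, and
    [pexp_splice] identifies the mean of [G]. *)
Lemma halve_maximal {R : realFieldType} (q : nat) (K kap : R) : 1 <= K -> 0 < kap <= 1 ->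
  exists C D : R, [/\ 0 < C, 0 < D &
  forall (I V J : finType) (mu x : I -> V -> R) (h : J -> {set I} -> R) (eps : R),
    admissible K kap mu x ->
    (forall j (U : {set I}), (q < #|U|)%N -> h j U = 0) -> 0 <= eps ->
    ppr mu (fun w => [exists j, C * eps < `|mpol x (halve (h j)) w|]) <=
    D * ppr mu (fun w => [exists j, eps < `|mpol x (h j) w|])].
Proof.
move=> K1 kap01; have [C [eta [C0 eta0 H]]] := halve_le q K1 kap01.
exists C, eta^-1; split; rewrite ?invr_gt0// => I V J mu x h eps.
move=> [mup x0 x2 [psi [psi0 psiK xpsi]]] hq eps0.
pose G w := ppr (splice_pmf mu) (fun z => [exists j, eps < `|mpol x (h j) (splice w z)|]).
have nup := splice_pmf_is_pmf mup.
rewrite -(ler_pM2l eta0) mulrA mulfV ?gt_eqF// mul1r.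
rewrite -[leRHS](pexp_splice _ mup) -pexpZ.
apply: le_pexp => // w; rewrite -/(G w).
have G0 : 0 <= G w by apply: pexp_ge0.
case: (boolP [exists j, _]) => [/existsP[j Cj]|_]; last by rewrite mulr0.
rewrite mulr1 leNgt; apply/negP => Geta; move: Cj; apply/negP; rewrite -leNgt.
apply: (H _ _ mu x psi) => //; first exact: hq.
apply: le_trans (ltW Geta); apply: ppr_le => // z jz.
by apply/existsP; exists j.
Qed.

(** * Extraction of one homogeneous component by interpolation *)

Lemma iter_halveE {R : realFieldType} {I : finType} (h : {set I} -> R) k U :
  iter k halve h U = h U * (2^-1 ^+ #|U|) ^+ k.
Proof.
elim: k => [|k IH]; first by rewrite mulr1.
by rewrite iterS /halve IH -mulrA -exprSr.
Qed.

Lemma iter_halve_maximal {R : realFieldType} (q k : nat) (K kap : R) :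
  1 <= K -> 0 < kap <= 1 ->
  exists C D : R, [/\ 0 < C, 0 < D &
  forall (I V J : finType) (mu x : I -> V -> R) (h : J -> {set I} -> R) (eps : R),
    admissible K kap mu x ->
    (forall j (U : {set I}), (q < #|U|)%N -> h j U = 0) -> 0 <= eps ->
    ppr mu (fun w => [exists j, C * eps < `|mpol x (iter k halve (h j)) w|]) <=
    D * ppr mu (fun w => [exists j, eps < `|mpol x (h j) w|])].
Proof.
move=> K1 kap01; elim: k => [|k [C [D [C0 D0 IH]]]].
  by exists 1, 1; split=> // *; rewrite !mul1r.
have [C' [D' [C'0 D'0 H]]] := halve_maximal q K1 kap01.
exists (C' * C), (D' * D); split; [exact: mulr_gt0|exact: mulr_gt0|].
move=> I V J mu x h eps adm hq eps0.
rewrite -!mulrA; apply: le_trans (H _ _ _ mu x (fun j => iter k halve (h j)) _ adm _ _) _.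
- by move=> j U qU; rewrite iter_halveE hq// mul0r.
- by rewrite mulr_ge0// ltW.
- by rewrite ler_pM2l// IH.
Qed.

(** The weights are the coefficients of the Lagrange polynomial vanishing at the nodes [2^-j] with
    [j != p], divided by its value at [2^-p]; the nodes are distinct. *)
Lemma interpolation_weights {R : numFieldType} (q p : nat) : (p <= q)%N ->
  exists (n : nat) (a : 'I_n -> R), forall j, (j <= q)%N ->
    \sum_k a k * (2^-1 ^+ j) ^+ k = (j == p)%:R.
Proof.
move=> pq.
pose L : {poly R} := \prod_(i < q.+1 | i != p :> nat) ('X - (2^-1 ^+ i)%:P).
have inj (i j : nat) : (2^-1 : R) ^+ i = 2^-1 ^+ j -> i = j.
  by apply: ieexprIn; rewrite ?invr_gt0// lt_eqF// invf_lt1// ltr1n.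
have LE j : L.[2^-1 ^+ j] = \prod_(i < q.+1 | i != p :> nat) (2^-1 ^+ j - 2^-1 ^+ i).
  by rewrite horner_prod; apply: eq_bigr => i _; rewrite !hornerE.
have Lp : L.[2^-1 ^+ p] != 0.
  rewrite LE; apply/prodf_neq0 => i ip; rewrite subr_eq0.
  by apply: contra_neq ip => /inj.
have Lj j : (j <= q)%N -> j != p -> L.[2^-1 ^+ j] = 0.
  move=> jq jp; rewrite LE (bigD1 (Ordinal (jq : (j < q.+1)%N)))//=.
  by rewrite subrr mul0r.
exists (size L), (fun k => L`_k / L.[2^-1 ^+ p]) => j jq.
transitivity (L.[2^-1 ^+ j] / L.[2^-1 ^+ p]).
  rewrite [in RHS]horner_coef mulr_suml; apply: eq_bigr => k _.
  by rewrite mulrAC.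
by case: eqVneq => [->|jp]; [rewrite mulfV|rewrite Lj// mul0r].
Qed.

Lemma ppr_sum_le {R : realFieldType} {I V : finType} (mu : I -> V -> R) n
    (A : pred {ffun I -> V}) (B : 'I_n -> pred {ffun I -> V}) :
  is_pmf mu -> (forall w, A w -> exists k, B k w) ->
  ppr mu A <= \sum_k ppr mu (B k).
Proof.
move=> mup AB; rewrite /ppr -pexp_sum; apply: le_pexp => // w.
case Aw: (A w); last by apply: sumr_ge0.
have [k Bk] := AB _ Aw.
by rewrite (bigD1 k)//= Bk lerDl sumr_ge0.
Qed.

(** The component is a fixed combination of the iterated halvings. If it is large, one of the
    iterates is large, and a union bound over finitely many iterates concludes. *)
Lemma component_maximal {R : realFieldType} (q p : nat) (K kap : R) :
  1 <= K -> 0 < kap <= 1 -> (p <= q)%N ->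
  exists C D : R, [/\ 0 < C, 0 < D &
  forall (I V J : finType) (mu x : I -> V -> R) (h : J -> {set I} -> R) (eps : R),
    admissible K kap mu x ->
    (forall j (U : {set I}), (q < #|U|)%N -> h j U = 0) -> 0 < eps ->
    ppr mu (fun w => [exists j, C * eps <
      `|\sum_(U : {set I} | #|U| == p) h j U * mono x U w|]) <=
    D * ppr mu (fun w => [exists j, eps < `|mpol x (h j) w|])].
Proof.
move=> K1 kap01 pq; have [n [a aP]] := @interpolation_weights R q p pq.
have [C' CDP] := choice (fun k : nat => iter_halve_maximal q k K1 kap01).
have {CDP} [D DP] := choice CDP.
pose C k := C' k.
(* The added 1 keeps the constants positive even when the sums vanish. *)
pose c := 1 + \sum_(k < n) `|a k| * C k; pose d := 1 + \sum_(k < n) D k.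
have C0 k : 0 < C k by have [] := DP k.
have D0 k : 0 < D k by have [] := DP k.
have Ck0 (k : 'I_n) : 0 <= `|a k| * C k by rewrite mulr_ge0// ltW.
exists c, d; split.
- by apply: ltr_wpDr => //; apply: sumr_ge0.
- by apply: ltr_wpDr => //; apply: sumr_ge0 => k _; exact: ltW.
move=> I V J mu x h eps adm hq eps0.
have mup : is_pmf mu by case: adm.
set rhs := (X in _ <= d * X).
have rhs0 : 0 <= rhs by apply: pexp_ge0.
pose A (k : 'I_n) w := [exists j, C k * eps < `|mpol x (iter k halve (h j)) w|].
have Ale k : ppr mu (A k) <= D k * rhs.
  by have [_ _ H] := DP k; exact: (H I V J mu x h eps adm hq (ltW eps0)).
apply: (@le_trans _ _ (\sum_k ppr mu (A k))).
  apply: ppr_sum_le => // w /existsP[j]; apply: contraPP => nA.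
  have {}nA (k : 'I_n) : `|mpol x (iter k halve (h j)) w| <= C k * eps.
    rewrite leNgt; apply/negP => jk; apply: nA; exists k.
    by apply/existsP; exists j.
  have -> : \sum_(U : {set I} | #|U| == p) h j U * mono x U w =
      \sum_k a k * mpol x (iter k halve (h j)) w.
    transitivity (\sum_(U : {set I}) (\sum_k a k * (2^-1 ^+ #|U|) ^+ k) * (h j U * mono x U w)).
      rewrite big_mkcond; apply: eq_bigr => U _.
      have [qU|Uq] := ltnP q #|U|; first by rewrite hq// mul0r mulr0 if_same.
      by rewrite aP//; case: eqP => _; rewrite ?mul1r ?mul0r.
    under eq_bigr do rewrite mulr_suml.
    rewrite exchange_big; apply: eq_bigr => k _.
    rewrite /mpol mulr_sumr; apply: eq_bigr => U _.
    by rewrite iter_halveE; ring.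
  apply/negP; rewrite -leNgt; apply: le_trans (ler_norm_sum _ _ _) _.
  rewrite /c mulrDl mul1r mulr_suml; apply: le_trans (_ : \sum_k `|a k| * C k * eps <= _).
    by apply: ler_sum => k _; rewrite normrM -mulrA ler_wpM2l.
  by rewrite lerDr ltW.
apply: le_trans (ler_sum _ (fun k _ => Ale k)) _.
by rewrite -mulr_suml /d ler_wpM2r// lerDr.
Qed.

Local Open Scope classical_set_scope.

(** * Discretisation of the variables *)

Section FiniteRange.
Context {d} {T : measurableType d} {R : realType} (P : probability T R).

Definition fpr (A : set T) : R := fine (P A).

Lemma fprK A : measurable A -> (fpr A)%:E = P A.
Proof.
move=> mA; rewrite fineK// ge0_fin_numE//.
by apply: le_lt_trans (probability_le1 P mA) _; rewrite ltry.
Qed.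

Lemma fpr_ge0 A : 0 <= fpr A.
Proof. exact: fine_ge0. Qed.

(** Measurability is expressed through level sets, so [W] carries no sigma-algebra; the integrand is
    a finite combination of indicators. *)
Lemma integrable_finite_range (W : finType) (Z : T -> W) (phi : W -> R) :
  (forall v, measurable (Z @^-1` [set v])) ->
  P.-integrable setT (EFin \o (phi \o Z)) /\
  (\int[P]_w (phi (Z w))%:E = (\sum_v fpr (Z @^-1` [set v]) * phi v)%:E)%E.
Proof.
move=> mZ.
have E w : (phi (Z w))%:E = (\sum_v (phi v)%:E * (\1_(Z @^-1` [set v]) w)%:E)%E.
  rewrite (bigD1 (Z w))//= indicE mem_set// mule1 big1 ?adde0// => v vZ.
  rewrite indicE memNset ?mule0// => /= Zv.
  by move: vZ; rewrite Zv eqxx.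
have int1 v : P.-integrable setT (fun w => (phi v)%:E * (\1_(Z @^-1` [set v]) w)%:E)%E.
  by apply: integrableZl => //; exact: integrable_indic.
split.
  rewrite (_ : _ \o _ = fun w => (\sum_v (phi v)%:E * (\1_(Z @^-1` [set v]) w)%:E)%E).
    exact: integrable_sum.
  by apply/funext => w; exact: E.
under eq_integral do rewrite E.
rewrite integral_sum// -sumEFin; apply: eq_bigr => v _.
rewrite integralZl//; last exact: integrable_indic.
by rewrite integral_indic// setIT EFinM fprK// muleC.
Qed.

Lemma measurable_finite_range (W : finType) (Z : T -> W) (A : set W) :
  (forall v, measurable (Z @^-1` [set v])) -> measurable (Z @^-1` A).
Proof.
move=> mZ; rewrite (_ : Z @^-1` A = \bigcup_(v in A) Z @^-1` [set v]).
  by apply: fin_bigcup_measurable.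
by apply/seteqP; split=> [w Aw|w [v Av /= ->]] //; exists (Z w).
Qed.

Lemma fpr_finite_range (W : finType) (Z : T -> W) (A : pred W) :
  (forall v, measurable (Z @^-1` [set v])) ->
  fpr [set w | A (Z w)] = \sum_v fpr (Z @^-1` [set v]) * (A v)%:R.
Proof.
move=> mZ; apply: EFin_inj; have [_ <-] := integrable_finite_range (fun v => (A v)%:R) mZ.
have mA : measurable [set w | A (Z w)] by exact: (measurable_finite_range [set v | A v] mZ).
rewrite fprK// -[in LHS](setIT [set w | A (Z w)]) -integral_indic//.
apply: eq_integral => w _; rewrite indicE; congr (_%:R%:E).
by case Aw: (A (Z w)); [rewrite mem_set|rewrite memNset//= Aw].
Qed.

End FiniteRange.

(** The interval from [-k] to [k] is cut into [2 * k * k] cells of length [1 / k]. A point is sent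
    to the left end of its cell, or to 0 when it lies outside the grid. *)
Lemma grid_discretisation {R : realType} (k : nat) : (0 < k)%N ->
  exists (V : finType) (D : R -> V) (g : V -> R),
    (forall v, measurable (D @^-1` [set v])) /\
    (forall y, `|g (D y) - y| <= k%:R^-1 \/ (g (D y) = 0 /\ k%:R <= `|y|)).
Proof.
move=> k0; pose n := (2 * k * k)%N.
have kR0 : 0 < k%:R :> R by rewrite ltr0n.
pose c (j : 'I_n) : R := - k%:R + j%:R / k%:R.
(* Recording all memberships at once makes each level set a finite intersection of intervals and
   complements of intervals. *)
pose D y := [ffun j => (c j <= y < c j + k%:R^-1)].
pose g (v : {ffun 'I_n -> bool}) := if [pick j | v j] is Some j then c j else 0.
exists {ffun 'I_n -> bool}, D, g; split=> [v|y].
  rewrite (_ : _ @^-1` _ = \bigcap_(j in [set: 'I_n]) [set y | (c j <= y < c j + k%:R^-1) = v j]).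
    apply: fin_bigcap_measurable => //= j _; case: (v j).
      rewrite (_ : [set _ | _] = `[c j, c j + k%:R^-1[%classic)//.
    rewrite (_ : [set _ | _] = ~` `[c j, c j + k%:R^-1[%classic); first exact: measurableC.
    by apply/seteqP; split=> y /=; rewrite in_itv/=; [move=> ->|move=> /negP/negPf].
  apply/seteqP; split=> y /=; first by move=> <- j _; rewrite /= ffunE.
  by move=> H; apply/ffunP => j; rewrite ffunE; exact: H.
rewrite /g; case: pickP => [j|nj].
  rewrite ffunE => /andP[jy yj]; left; rewrite ler_norml.
  by apply/andP; split; lra.
right; split=> //; rewrite leNgt; apply/negP; rewrite ltr_norml => /andP[ky yk].
(* The integer part of [u] is the index of the cell containing [y]. *)
pose u := (y + k%:R) * k%:R.
have u0 : 0 <= u by rewrite mulr_ge0//; lra.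
have /andP[tu ut] := truncn_itv u0.
have tn : (Num.truncn u < n)%N.
  rewrite -(ltr_nat R); apply: le_lt_trans tu _.
  by rewrite /u /n !natrM ltr_pM2r//; lra.
have := nj (Ordinal tn); rewrite ffunE /c/=.
move/negP; apply; apply/andP; split.
  by rewrite addrC -lerBrDr opprK ler_pdivrMr.
rewrite -[X in _ + X]mul1r -addrA -mulrDl natr1 addrC -ltrBlDr opprK.
by rewrite ltr_pdivlMr.
Qed.

Section Discretise.
Context {d} {T : measurableType d} {R : realType} (P : probability T R).

Lemma measurable_preimage (V : finType) (Y : T -> R) (D : R -> V) v :
  measurable_fun setT Y -> (forall v, measurable (D @^-1` [set v])) ->
  measurable ((D \o Y) @^-1` [set v]).
Proof. by move=> mY mD; rewrite -[X in measurable X]setTI; exact: (mY measurableT _ (mD v)). Qed.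

(** Integrating the pointwise bound uses only the moments 1, 0, 1 and at most [M]. Every estimate on
    the discretised law below is an instance of this. *)
Lemma mean_discrete_le (Y : T -> R) (delta M : R) (V : finType) (D : R -> V)
    (phi : V -> R) (a b c e : R) :
  measurable_fun setT Y -> ('E_P[Y] = 0)%E -> ('E_P[fun w => (Y w ^+ 2)%R] = 1)%E ->
  ('E_P[fun w => (`|Y w| `^ (2 + delta))%R] <= M%:E)%E ->
  (forall v, measurable (D @^-1` [set v])) -> 0 <= e ->
  (forall y, phi (D y) <= a + b * y + c * y ^+ 2 + e * `|y| `^ (2 + delta)) ->
  \sum_v fpr P (Y @^-1` (D @^-1` [set v])) * phi v <= a + c + e * M.
Proof.
move=> mY; rewrite unlock => EY EY2 EYd mD e0 phile.
have mY2 : measurable_fun setT (fun w => Y w ^+ 2) by exact: measurable_funX.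
have mYd : measurable_fun setT (fun w => `|Y w| `^ (2 + delta)).
  apply: (measurableT_comp (measurable_powR (2 + delta))).
  exact: (measurableT_comp (@normr_measurable R setT)).
have iY2 : P.-integrable setT (EFin \o (fun w => Y w ^+ 2)).
  apply/integrableP; split; first exact/measurable_EFinP.
  rewrite (eq_integral (fun w => (Y w ^+ 2)%:E)) ?EY2 ?ltry// => w _.
  by rewrite /= ger0_norm ?sqr_ge0.
have iYd : P.-integrable setT (EFin \o (fun w => `|Y w| `^ (2 + delta))).
  apply/integrableP; split; first exact/measurable_EFinP.
  rewrite (eq_integral (fun w => (`|Y w| `^ (2 + delta))%:E)).
    by apply: le_lt_trans EYd _; rewrite ltry.
  by move=> w _; rewrite /= ger0_norm ?powR_ge0.
have i1 (r : R) : P.-integrable setT (EFin \o (fun=> r)).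
  exact: finite_measure_integrable_cst.
have iY : P.-integrable setT (EFin \o Y).
  apply: (@le_integrable _ _ _ P setT measurableT _ (EFin \o (fun w => 1 + Y w ^+ 2))).
  - exact/measurable_EFinP.
  - move=> w _; rewrite /= lee_fin [leRHS]ger0_norm ?addr_ge0 ?sqr_ge0//.
    rewrite -[Y w ^+ 2]real_normK ?num_real//.
    have := sqr_ge0 (`|Y w| - 1); have := normr_ge0 (Y w); lra.
  - rewrite (_ : _ \o _ = ((EFin \o (fun=> 1%R)) \+ (EFin \o (fun w => (Y w ^+ 2)%R)))%E).
      exact: integrableD.
    by apply/funext => w.
rewrite -lee_fin.
have [iphi <-] := integrable_finite_range P phi (fun v => measurable_preimage v mY mD).
have zY := integrableZl measurableT b iY.
have zY2 := integrableZl measurableT c iY2.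
have zYd := integrableZl measurableT e iYd.
have ia := i1 a.
pose r w := (a%:E + b%:E * (Y w)%:E + c%:E * (Y w ^+ 2)%:E + e%:E * (`|Y w| `^ (2 + delta))%:E)%E.
have ir1 : P.-integrable setT (fun w => (a%:E + b%:E * (Y w)%:E)%E).
  exact: integrableD.
have ir2 : P.-integrable setT (fun w => (a%:E + b%:E * (Y w)%:E + c%:E * (Y w ^+ 2)%:E)%E).
  exact: integrableD.
have ir : P.-integrable setT r.
  exact: integrableD.
apply: (@le_trans _ _ (\int[P]_w r w)%E).
  by apply: le_integral => // w _; rewrite /r/= -!EFinM -!EFinD lee_fin phile.
rewrite /r integralD// integralD// integralD//.
rewrite (integralZl measurableT iYd) (integralZl measurableT iY2).
rewrite (integralZl measurableT iY) EY EY2 mule0 adde0 mule1.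
have Ea : (\int[P]_w a%:E)%E = a%:E by have := expectation_cst P a; rewrite unlock.
rewrite Ea EFinD EFinD EFinM.
by apply: leeD => //; apply: lee_wpmul2l.
Qed.

End Discretise.

Definition discrete_law {d} {T : measurableType d} {R : realType} (P : probability T R)
  (X : nat -> T -> R) {V : finType} (D : R -> V) {N : nat} (i : 'I_N) (v : V) : R :=
  fpr P (X i @^-1` (D @^-1` [set v])).

(** Values are rounded to a grid and recentred. The dual function is the rounded value truncated at
    a fixed level and recentred; the moment of order [2 + delta] makes the variance beyond that
    level uniformly small, so the correlation stays above one half. *)
Lemma exists_discretisation {d} {T : measurableType d} {R : realType}
    (P : probability T R) (X : nat -> T -> R) (delta M : R) :
  (forall i, measurable_fun setT (X i)) ->
  (forall i, 'E_P[X i] = 0)%E ->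
  (forall i, 'E_P[fun w => (X i w ^+ 2)%R] = 1)%E ->
  0 < delta ->
  (forall j, ('E_P[fun w => (`|X j w| `^ (2 + delta))%R] <= M%:E)%E) ->
  exists2 K : R, 1 <= K & exists k0 : nat, forall k, (k0 <= k)%N ->
  exists (V : finType) (D : R -> V) (x : nat -> V -> R),
    [/\ forall v, measurable (D @^-1` [set v]),
        forall N, admissible K (2^-1) (@discrete_law d T R P X V D N) (fun (i : 'I_N) v => x i v) &
        forall i y, `|x i (D y) - y| <= (3 + y ^+ 2) / k%:R].
Proof.
move=> mX EX EX2 delta0 EXd.
have M0 : 0 <= M.
  rewrite -lee_fin; apply: le_trans (EXd 0%N); rewrite unlock.
  by apply: integral_ge0 => w _; rewrite lee_fin powR_ge0.
(* Above this level [y ^ 2] is at most [|y| ^ (2 + delta) / (4 * M + 1)], whose mean is at most one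
   quarter. *)
pose K0 : R := (4 * M + 1) `^ (delta^-1).
have K01 : 1 <= K0.
  have E1 : 1 `^ (delta^-1) = 1 :> R by rewrite powR1.
  rewrite -E1 /K0.
  by apply: ge0_ler_powR; rewrite ?nnegrE ?invr_ge0 ?(ltW delta0)//; lra.
have K0d y : K0 <= y -> 4 * M + 1 <= y `^ delta.
  move=> Ky; have -> : 4 * M + 1 = K0 `^ delta.
    by rewrite /K0 -powRrM mulVf ?gt_eqF// powRr1//; lra.
  by apply: ge0_ler_powR; rewrite ?nnegrE ?(ltW delta0)//; lra.
have powd y : K0 <= `|y| -> (4 * M + 1) * y ^+ 2 <= `|y| `^ (2 + delta).
  move=> Ky; have y0 : `|y| != 0 by apply/eqP => y0; rewrite y0 in Ky; lra.
  rewrite powRD ?y0 ?implybT// powR_mulrn ?normr_ge0// real_normK ?num_real//.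
  by rewrite mulrC ler_wpM2l ?sqr_ge0// K0d.
(* The extra unit absorbs rounding: a rounded value beyond [K] comes from a point beyond [K0].
   Recentring the truncation then doubles the bound. *)
pose K := K0 + 1.
exists (2 * K); first by rewrite /K; lra.
(* For such [k] the rounding error [(2 * K + 1) / k] and the recentring error [2 * K / k] add up to
   at most one quarter. *)
exists (Num.truncn (16 * K + 4)).+1 => k kk0.
have Kk : 16 * K + 4 <= k%:R.
  have /andP[_ /ltW h] : (Num.truncn (16 * K + 4))%:R <= 16 * K + 4 < (Num.truncn (16 * K + 4)).+1%:R.
    by apply: truncn_itv; rewrite /K; lra.
  by apply: le_trans h _; rewrite ler_nat.
have k0 : (0 < k)%N by exact: leq_trans kk0.
have kR0 : 0 < k%:R :> R by rewrite ltr0n.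
have [V [D [g [mD gD]]]] := @grid_discretisation R k k0.
pose kk : R := k%:R^-1.
have kk0' : 0 < kk by rewrite invr_gt0.
have kkE : kk * k%:R = 1 by rewrite mulVf ?gt_eqF.
have kkK : (16 * K + 4) * kk <= 1 by rewrite -[leRHS]kkE [leLHS]mulrC ler_wpM2l// ltW.
(* Off the grid the rounded value is 0 and [|y| >= k] gives [|y| <= y ^ 2 / k], so one quadratic
   bound covers both cases. *)
have gD1 y : `|g (D y) - y| <= kk + kk * y ^+ 2.
  have [h|[-> ky]] := gD y.
    by apply: le_trans h _; rewrite lerDl mulr_ge0 ?sqr_ge0// ltW.
  rewrite sub0r normrN -[y ^+ 2]real_normK ?num_real//.
  have : `|y| <= kk * `|y| ^+ 2.
    rewrite expr2 mulrA -[leLHS]mul1r ler_wpM2r//.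
    by rewrite -kkE ler_wpM2l// ltW.
  lra.
pose mu i v := fpr P (X i @^-1` (D @^-1` [set v])).
have mean i phi a b c e := fun e0 => @mean_discrete_le _ _ _ P (X i) delta M V D phi a b c e
  (mX i) (EX i) (EX2 i) (EXd i) mD e0.
have kk4 : kk <= 4^-1.
  have : kk * 1 <= kk * K by rewrite ler_wpM2l ?(ltW kk0')// /K; lra.
  have := kkK; have := kk0'; lra.
have mu0 i v : 0 <= mu i v by exact: fpr_ge0.
have mu1 i : \sum_v mu i v = 1.
  apply/eqP; rewrite eq_le; apply/andP; split.
    have := mean i (fun=> 1) 1 0 0 0 (lexx 0).
    under eq_bigr do rewrite mulr1.
    by move=> h; apply: le_trans (h _) _ => [y|]; lra.
  have := mean i (fun=> -1) (-1) 0 0 0 (lexx 0).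
  under eq_bigr do rewrite mulrN1.
  rewrite sumrN => h; rewrite -[leRHS]opprK lerNr; apply: le_trans (h _) _ => [y|]; lra.
pose m i := \sum_v mu i v * g v.
have m_le i : `|m i| <= 2 * kk.
  rewrite ler_norml; apply/andP; split.
    have := mean i (fun v => - g v) kk (-1) kk 0 (lexx 0).
    under eq_bigr do rewrite mulrN.
    rewrite sumrN -/(m i) => h; rewrite lerNl; apply: le_trans (h _) _ => [y|]; last by lra.
    by have := gD1 y; rewrite ler_norml => /andP[]; lra.
  have := mean i g kk 1 kk 0 (lexx 0).
  rewrite -/(m i) => h; apply: le_trans (h _) _ => [y|]; last by lra.
  by have := gD1 y; rewrite ler_norml => /andP[]; lra.
have g2_le i : \sum_v mu i v * g v ^+ 2 <= 4.
  have := mean i (fun v => g v ^+ 2) (2 * kk ^+ 2) 0 2 0 (lexx 0).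
  move=> h; apply: le_trans (h _) _ => [y|].
    rewrite mul0r mul0r !addr0.
    have [h1|[-> _]] := gD y.
      have : (g (D y) - y) ^+ 2 <= kk ^+ 2.
        by rewrite -[leLHS]real_normK ?num_real// ler_pXn2r// nnegrE ltW.
      have := sqr_ge0 (g (D y) - 2 * y); lra.
    by rewrite expr0n/=; have := sqr_ge0 kk; have := sqr_ge0 y; lra.
  have : kk ^+ 2 <= kk * 1 by rewrite expr2 ler_wpM2l ?(ltW kk0')//; lra.
  lra.
pose g1 v := if `|g v| <= K then g v else 0.
have g1K v : `|g1 v| <= K.
  by rewrite /g1; case: ifP => // _; rewrite normr0 /K; lra.
pose n i := \sum_v mu i v * g1 v.
have n_le i : `|n i| <= K.
  apply: le_trans (ler_norm_sum _ _ _) _.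
  rewrite (eq_bigr (fun v => mu i v * `|g1 v|)).
    exact: mean_le.
  by move=> v _; rewrite normrM ger0_norm.
(* Pointwise, [y ^ 2 - g * g1] is bounded by the rounding error plus the tail term; the latter costs
   at most [M / (4 * M + 1) <= 1 / 4]. *)
have gg1_ge i : 3 / 4 - (2 * K + 1) * kk <= \sum_v mu i v * (g v * g1 v).
  have Mpos : 0 < 4 * M + 1 by lra.
  have iM0 : 0 <= (4 * M + 1)^-1 by rewrite invr_ge0 ltW.
  have := mean i (fun v => - (g v * g1 v)) ((2 * K + 1) * kk) 0 (-1) ((4 * M + 1)^-1) iM0.
  under eq_bigr do rewrite mulrN.
  rewrite sumrN => h; rewrite -[leRHS]opprK lerNr; apply: le_trans (h _) _ => [y|]; last first.
    have : (4 * M + 1)^-1 * M <= 4^-1.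
      by rewrite mulrC ler_pdivrMr; lra.
    lra.
  rewrite mul0r addr0 mulN1r.
  have tail : K0 <= `|y| -> y ^+ 2 <= (4 * M + 1)^-1 * `|y| `^ (2 + delta).
    by move=> Ky; rewrite mulrC ler_pdivlMr// mulrC powd.
  have Kkk : 0 <= (2 * K + 1) * kk by rewrite mulr_ge0 ?(ltW kk0')// /K; lra.
  have tail0 : 0 <= (4 * M + 1)^-1 * `|y| `^ (2 + delta) by rewrite mulr_ge0 ?powR_ge0.
  rewrite /g1; case: ifPn => [gK|].
    have [h1|[-> ky]] := gD y; last first.
      rewrite mul0r oppr0.
      have /tail : K0 <= `|y| by apply: le_trans ky; apply: le_trans Kk; rewrite /K; lra.
      lra.
    have : y ^+ 2 - g (D y) * g (D y) <= kk * (2 * K + 1).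
      have -> : y ^+ 2 - g (D y) * g (D y) = (y - g (D y)) * (y + g (D y)) by ring.
      apply: le_trans (ler_norm _) _; rewrite normrM; apply: ler_pM => //.
        by rewrite distrC.
      have -> : y + g (D y) = (y - g (D y)) + 2 * g (D y) by ring.
      apply: le_trans (ler_normD _ _) _; rewrite normrM (ger0_norm (_ : 0 <= 2))//.
      rewrite distrC; move: h1; rewrite -/kk; lra.
    lra.
  rewrite -ltNge => Kg; rewrite mulr0 oppr0.
  have [h1|[g0 _]] := gD y; last by rewrite g0 normr0 /K in Kg; lra.
  have /tail : K0 <= `|y|.
    have := ler_normD (g (D y) - y) y; rewrite subrK; move: h1 Kg; rewrite -/kk /K; lra.
  lra.
have meanc i c : \sum_v mu i v * c = c by rewrite -mulr_suml mu1 mul1r.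
have mE i : m i = \sum_v mu i v * g v by [].
have nE i : n i = \sum_v mu i v * g1 v by [].
clearbody m n.
exists V, D, (fun i v => g v - m i); split=> // [N|i y]; last first.
  have -> : g (D y) - m i - y = (g (D y) - y) - m i by ring.
  apply: le_trans (ler_normB _ _) _; rewrite mulrDl [y ^+ 2 * _]mulrC -/kk.
  have := gD1 y; have := m_le i; lra.
split.
- by split=> [i v|i]; [exact: fpr_ge0|exact: mu1].
- move=> i; rewrite -[RHS](subrr (m i)) -{3}(meanc i (m i)) {2}mE -sumrB.
  by apply: eq_bigr => v _; rewrite mulrBr.
- move=> i.
  have -> : \sum_v discrete_law P X D i v * (g v - m i) ^+ 2 =
     \sum_v mu i v * g v ^+ 2 - 2 * m i * m i + m i ^+ 2.
    rewrite -[X in _ = _ + X](meanc i) {3}mE mulr_sumr -sumrB -big_split/=.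
    by apply: eq_bigr => v _; rewrite /discrete_law -/(mu i v); ring.
  have := g2_le i; have := sqr_ge0 (m i); lra.
exists (fun (i : 'I_N) v => g1 v - n i); split.
- move=> i; rewrite -[RHS](subrr (n i)) -{3}(meanc i (n i)) {2}nE -sumrB.
  by apply: eq_bigr => v _; rewrite mulrBr.
- move=> i v; apply: le_trans (ler_normB _ _) _.
  by have := g1K v; have := n_le i; lra.
move=> i.
have -> : \sum_v discrete_law P X D i v * ((g v - m i) * (g1 v - n i)) =
    \sum_v mu i v * (g v * g1 v) - n i * m i - m i * n i + m i * n i.
  rewrite -[X in _ = _ + X](meanc i) {2}mE {3}nE !mulr_sumr -!sumrB -big_split/=.
  by apply: eq_bigr => v _; rewrite /discrete_law -/(mu i v); ring.
have : m i * n i <= 2 * kk * K.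
  by apply: le_trans (ler_norm _) _; rewrite normrM; apply: ler_pM.
have := gg1_ge i; have := kkK; lra.
Qed.

Local Close Scope classical_set_scope.

(** * From independent variables to product laws *)

Definition discrete_vec {T : Type} {R : realType} (X : nat -> T -> R) {V : finType}
  (D : R -> V) (N : nat) (w : T) : {ffun 'I_N -> V} := [ffun i : 'I_N => D (X i w)].

Definition discretised {T : Type} {R : realType} (X : nat -> T -> R) {V : finType}
  (D : R -> V) (x : nat -> V -> R) (i : nat) (w : T) : R := x i (D (X i w)).

Section DiscreteLaw.
Context {d} {T : measurableType d} {R : realType} (P : probability T R) (X : nat -> T -> R)
  {V : finType} (D : R -> V) (N : nat).
Hypotheses (mX : forall i, measurable_fun [set: T]%classic (X i))
  (indX : mutually_independent P X)
  (mD : forall v, measurable (D @^-1` [set v])%classic).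

(** Independence is stated with one set per natural number, so indices outside ['I_N] receive the
    whole line. *)
Let cell (t : {ffun 'I_N -> V}) (i : nat) : set R :=
  if insub i is Some j then (D @^-1` [set t j])%classic else [set: R]%classic.

Let discrete_vec_cell t :
  ((discrete_vec X D N) @^-1` [set t] =
   \big[setI/setT]_(i <- iota 0 N) (X i @^-1` cell t i))%classic.
Proof.
rewrite -bigcap_seq; apply/seteqP; split=> [w /= <- i|w H].
  rewrite /= mem_iota/= add0n => iN.
  by rewrite /cell insubT/= ffunE.
apply/ffunP => i; have := H i; rewrite /= mem_iota/= add0n ltn_ord => /(_ isT).
rewrite /cell (insubT (fun m => (m < N)%N) (ltn_ord i))/= => cE.
by rewrite ffunE cE; congr (t _); exact: val_inj.
Qed.

Let measurable_cell t i : measurable (cell t i).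
Proof. by rewrite /cell; case: insubP. Qed.

Lemma measurable_discrete_vec t : measurable (discrete_vec X D N @^-1` [set t])%classic.
Proof.
rewrite discrete_vec_cell; apply: bigsetI_measurable => i _.
by rewrite -[X in measurable X]setTI; exact: mX.
Qed.

(** This is where independence enters: it gives the discretised vector the product law [pmass]. *)
Lemma fpr_discrete_vec (A : pred {ffun 'I_N -> V}) :
  fpr P [set w | A (discrete_vec X D N w)]%classic = ppr (discrete_law P X D) A.
Proof.
rewrite fpr_finite_range; last exact: measurable_discrete_vec.
apply: eq_bigr => t _; congr (_ * _).
rewrite /fpr discrete_vec_cell indX ?iota_uniq//.
transitivity (fine (\prod_(i < N) (discrete_law P X D i (t i))%:E)%E); last first.
  by rewrite prodEFin.
congr fine; rewrite -[in LHS](subn0 N) -/(index_iota 0 N) big_mkord.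
apply: eq_bigr => i _; rewrite /discrete_law fprK//; last exact: measurable_preimage.
rewrite /cell (insubT (fun m => (m < N)%N) (ltn_ord i))/=.
by have -> : Sub (i : nat) (ltn_ord i) = i by exact: val_inj.
Qed.

End DiscreteLaw.

Lemma prod_image {R : comNzRingType} {N p : nat} (i : {ffun 'I_p -> 'I_N}) (y : 'I_N -> R) :
  injective i -> \prod_(j in i @: finset.setT) y j = \prod_(k < p) y (i k).
Proof.
move=> inj_i; rewrite big_imset/=; last by move=> j k _ _; exact: inj_i.
by apply: eq_bigl => k; rewrite finset.in_setT.
Qed.

(** The sum runs over the enumerations of [U]; for symmetric [f] it is the factorial of [#|U|] times
    the common value. *)
Definition set_coef {R : realType} (f : forall p : nat, ('I_p -> nat) -> R) (N : nat)
  (U : {set 'I_N}) : R :=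
  \sum_(i : {ffun 'I_#|U| -> 'I_N} | i @: finset.setT == U) f #|U| (fun k => i k : nat).

(** Tuples are grouped by their image. Those with a repeated index vanish by the diagonal condition,
    and the others enumerate a set of size [p]. *)
Lemma homsum_partial_sets {T : Type} {R : realType} (f : forall p : nat, ('I_p -> nat) -> R)
    (Y : nat -> T -> R) (p N : nat) w :
  (forall (i : 'I_p -> nat) j k, j != k -> i j = i k -> f p i = 0) ->
  homsum_partial Y (f p) N w =
  \sum_(U : {set 'I_N} | #|U| == p) set_coef f U * \prod_(i in U) Y i w.
Proof.
move=> fdiag.
have f0 (i : {ffun 'I_p -> 'I_N}) : ~~ injectiveb i -> f p (fun k => i k : nat) = 0.
  by move=> /injectivePn[j [k jk ijk]]; apply: (fdiag _ j k) => //; rewrite ijk.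
rewrite /homsum_partial (partition_big (fun i : {ffun 'I_p -> 'I_N} => i @: finset.setT) xpredT)//=.
rewrite [RHS]big_mkcond; apply: eq_bigr => U _.
case: eqP => [pU|pU]; last first.
  apply: big1 => i /eqP iU; rewrite f0 ?mul0r//; apply/negP => /injectiveP inj_i.
  by apply: pU; rewrite -iU card_imset// finset.cardsT card_ord.
have -> : set_coef f U =
    \sum_(i : {ffun 'I_p -> 'I_N} | i @: finset.setT == U) f p (fun k => i k : nat).
  (* The type of the coefficient depends on the degree, so the equality of [#|U|] and [p] is
     eliminated rather than rewritten. *)
  by rewrite /set_coef; case: p / pU {f0 fdiag}.
rewrite mulr_suml; apply: eq_bigr => i /eqP iU.
have [/injectiveP inj_i|/f0 ->] := boolP (injectiveb i); last by rewrite !mul0r.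
by rewrite -iU prod_image.
Qed.

(** [C] and [B] are chosen before the probability space, the alphabet, [N] and [J], so that
    discretisation and truncation can be refined later at no cost. *)
Lemma discrete_maximal {R : realType} (q p : nat) (K kap : R) :
  1 <= K -> 0 < kap <= 1 -> (p <= q)%N ->
  exists C B : R, [/\ 0 < C, 0 < B &
  forall d (T : measurableType d) (P : probability T R) (X : nat -> T -> R)
    (V : finType) (D : R -> V) (x : nat -> V -> R) (N : nat) (J : finType)
    (f : J -> forall p : nat, ('I_p -> nat) -> R) (eps : R),
    (forall i, measurable_fun [set: T]%classic (X i)) -> mutually_independent P X ->
    (forall v, measurable (D @^-1` [set v])%classic) ->
    admissible K kap (@discrete_law d T R P X V D N) (fun (i : 'I_N) v => x i v) ->
    (forall j r, (r <= q)%N -> forall (i : 'I_r -> nat) k l, k != l -> i k = i l -> f j r i = 0) ->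
    0 < eps ->
    fpr P [set w | [exists j, C * eps < `|homsum_partial (discretised X D x) (f j p) N w|]]%classic <=
    B * fpr P [set w | [exists j, eps <
      `|\sum_(r < q.+1) homsum_partial (discretised X D x) (f j r) N w|]]%classic].
Proof.
move=> K1 kap01 pq; have [C [B [C0 B0 H]]] := component_maximal K1 kap01 pq.
exists C, B; split=> // d T P X V D x N J f eps mX indX mD adm fdiag eps0.
set Z := discretised X D x.
(* Coefficients are cut at degree [q]: the family [f j] is controlled only up to that degree. *)
pose h j (U : {set 'I_N}) : R := if (#|U| <= q)%N then set_coef (f j) U else 0.
have hq j (U : {set 'I_N}) : (q < #|U|)%N -> h j U = 0 by rewrite ltnNge /h => /negbTE ->.
have := H _ _ J (@discrete_law d T R P X V D N) (fun (i : 'I_N) v => x i v) h eps adm hq eps0.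
have monoE w (U : {set 'I_N}) :
    mono (fun (i : 'I_N) v => x i v) U (discrete_vec X D N w) = \prod_(i in U) Z i w.
  by apply: eq_bigr => i _; rewrite ffunE.
have compE j r w : (r <= q)%N -> \sum_(U : {set 'I_N} | #|U| == r) h j U *
    mono (fun (i : 'I_N) v => x i v) U (discrete_vec X D N w) = homsum_partial Z (f j r) N w.
  move=> rq; rewrite homsum_partial_sets; last exact: fdiag.
  by apply: eq_bigr => U /eqP Ur; rewrite monoE /h Ur rq.
rewrite -!fpr_discrete_vec//.
congr (fpr P _ <= _ * fpr P _); apply/funext => w; congr is_true;
  apply: eq_existsb => j; congr (_ < `|_|); first exact: compE.
rewrite /mpol (bigID (fun U : {set 'I_N} => (#|U| <= q)%N))/= addrC big1 ?add0r; last first.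
  by move=> U; rewrite -ltnNge => qU; rewrite hq// mul0r.
rewrite (partition_big (fun U : {set 'I_N} => inord #|U| : 'I_q.+1) xpredT)//=.
apply: eq_bigr => r _; rewrite -compE; last by rewrite -ltnS.
apply: eq_bigl => U; apply/andP/eqP => [[Uq /eqP <-]|Ur].
  by rewrite inordK.
by rewrite Ur -ltnS ltn_ord; split=> //; apply/eqP/val_inj; rewrite /= inordK.
Qed.

Local Open Scope classical_set_scope.

(** * Almost sure convergence *)

Lemma measurable_norm_gt {d} {T : measurableType d} {R : realType} (U : T -> R) (e : R) :
  measurable_fun setT U -> measurable [set w | e < `|U w|].
Proof.
move=> mU; rewrite -[X in measurable X]setTI.
rewrite (_ : [set w | e < `|U w|] = (Num.norm \o U) @^-1` `]e, +oo[).
  exact: (measurableT_comp (@normr_measurable R setT) mU).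
by apply/seteqP; split=> w /=; rewrite in_itv/= andbT.
Qed.

Section TailEvents.
Context {d} {T : measurableType d} {R : realType} (P : probability T R).

Lemma fpr_le (A B : set T) : measurable A -> measurable B -> A `<=` B ->
  fpr P A <= fpr P B.
Proof.
by move=> mA mB AB; rewrite -lee_fin !fprK//; apply: le_measure; rewrite ?inE.
Qed.

Lemma fprU_le (A B : set T) : measurable A -> measurable B ->
  fpr P (A `|` B) <= fpr P A + fpr P B.
Proof.
move=> mA mB; rewrite -lee_fin EFinD !fprK//; last exact: measurableU.
exact: measureU2.
Qed.

(** A finite window of indices, as the maximal inequality concerns finite families; [exceeds_tail]
    is its increasing limit in [k]. *)
Definition exceeds (U : nat -> T -> R) (e : R) (m k : nat) : set T :=
  [set w | [exists j : 'I_k, e < `|U (m + j)%N w|]].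

Definition exceeds_tail (U : nat -> T -> R) (e : R) (m : nat) : set T :=
  \bigcup_n [set w | e < `|U (m + n)%N w|].

Lemma exceedsE U e m k :
  exceeds U e m k = \bigcup_(j in [set: 'I_k]) [set w | e < `|U (m + j)%N w|].
Proof.
apply/seteqP; split=> w /=; first by move=> /existsP[j ej]; exists j.
by move=> [j _ ej]; apply/existsP; exists j.
Qed.

Lemma measurable_exceeds U e m k : (forall n, measurable_fun setT (U n)) ->
  measurable (exceeds U e m k).
Proof.
move=> mU; rewrite exceedsE; apply: fin_bigcup_measurable => // j _.
exact: measurable_norm_gt.
Qed.

Lemma measurable_exceeds_tail U e m : (forall n, measurable_fun setT (U n)) ->
  measurable (exceeds_tail U e m).
Proof. by move=> mU; apply: bigcup_measurable => j _; exact: measurable_norm_gt. Qed.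

(** Continuity from above: the tail events decrease to a set on which convergence to 0 fails. *)
Lemma exceeds_tail_small (U : nat -> T -> R) (e rho : R) :
  (forall n, measurable_fun setT (U n)) ->
  {ae P, forall w, U ^~ w @ \oo --> (0 : R)} -> 0 < e -> 0 < rho ->
  exists m, fpr P (exceeds_tail U e m) <= rho.
Proof.
move=> mU aeU e0 rho0; pose S := exceeds_tail U e.
have mS m : measurable (S m) by exact: measurable_exceeds_tail.
have mcap : measurable (\bigcap_m S m) by exact: bigcap_measurableType.
have cap0 : P (\bigcap_m S m) = 0%E.
  apply: measure_negligible => //; apply: negligibleS aeU => w Sw /= Uw.
  have /cvgr0Pnorm_lt/(_ e e0)[m _ mP] := Uw.
  have [n _ /= en] := Sw m I.
  by have /= := mP (m + n)%N (leq_addr _ _); rewrite ltNge ltW.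
have dec : {homo S : n m / (n <= m)%N >-> (m <= n)%O}.
  move=> n m nm; apply/subsetPset => w [j _ /= ej].
  by exists (m - n + j)%N => //=; rewrite addnA subnKC.
have fin0 : (P (S 0%N) < +oo)%E.
  by apply: le_lt_trans (probability_le1 P (mS _)) _; rewrite ltry.
have cv : P \o S @ \oo --> 0%E by rewrite -cap0; exact: nonincreasing_cvg_mu.
move: cv => /fine_cvg/cvgr0Pnorm_lt/(_ rho rho0)[m _ mP].
exists m; have /= := mP m (leqnn m); rewrite ger0_norm ?fine_ge0//.
exact: ltW.
Qed.

(** Continuity from below turns a bound uniform in the window length into a bound on the tail event.
    Divergence is then covered by the null sets obtained for the levels [1 / (j + 1)]. *)
Lemma ae_cvg0_exceeds (U : nat -> T -> R) :
  (forall n, measurable_fun setT (U n)) ->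
  (forall e rho : R, 0 < e -> 0 < rho -> exists m, forall k, fpr P (exceeds U e m k) <= rho) ->
  {ae P, forall w, U ^~ w @ \oo --> (0 : R)}.
Proof.
move=> mU HU.
have tail_le (e rho : R) : 0 < e -> 0 < rho -> exists m, fpr P (exceeds_tail U e m) <= rho.
  move=> e0 rho0; have [m mP] := HU e rho e0 rho0; exists m.
  have mE k : measurable (exceeds U e m k) by exact: measurable_exceeds.
  have inc : {homo exceeds U e m : n k / (n <= k)%N >-> (n <= k)%O}.
    move=> n k nk; apply/subsetPset => w /existsP[j ej].
    by apply/existsP; exists (widen_ord nk j).
  have capE : \bigcup_k exceeds U e m k = exceeds_tail U e m.
    apply/seteqP; split=> w; first by move=> [k _ /existsP[j ej]]; exists j.
    by move=> [n _ ej]; exists n.+1 => //; apply/existsP; exists ord_max.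
  have mtail : measurable (\bigcup_k exceeds U e m k) by exact: bigcup_measurable.
  have cv : P \o exceeds U e m @ \oo --> P (\bigcup_k exceeds U e m k).
    exact: nondecreasing_cvg_mu.
  rewrite -lee_fin fprK -capE//.
  rewrite -(cvg_lim _ cv)//; apply: lime_le; first exact: cvgP cv.
  by apply: nearW => k /=; rewrite -fprK ?lee_fin.
pose N (j : nat) := \bigcap_m exceeds_tail U (j.+1%:R^-1) m.
have jp (j : nat) : 0 < j.+1%:R^-1 :> R by rewrite invr_gt0.
have mN j : measurable (N j).
  by apply: bigcap_measurableType => m _; exact: measurable_exceeds_tail.
have N0 j : P.-negligible (N j).
  apply/negligibleP => //; transitivity ((fpr P (N j))%:E); first by rewrite fprK.
  congr EFin; apply/eqP.
  rewrite eq_le fpr_ge0 andbT; apply/ler_addgt0Pl => rho rho0; rewrite addr0.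
  have [m mP] := tail_le (j.+1%:R^-1) rho (jp j) rho0.
  apply: le_trans mP; apply: fpr_le => //; first exact: measurable_exceeds_tail.
  by move=> w; exact.
apply: negligibleS (negligible_bigcup N0) => w /= nU.
apply: contrapT => nN; apply: nU; apply/cvgr0Pnorm_lt => e e0.
have [j _ jP] := near_infty_natSinv_lt (PosNum e0).
have /= je := jP j (leqnn j).
have : ~ N j w by move=> Nj; apply: nN; exists j.
move=> /existsNP[m /not_implyP[_ nm]]; exists m => // n /= mn.
apply: le_lt_trans je; rewrite leNgt; apply/negP => nj; apply: nm.
by exists (n - m)%N => //=; rewrite subnKC.
Qed.

End TailEvents.

(** * Convergence in probability and passage from discretised partial sums to the limit *)

Definition cvg_in_prob {d} {T : measurableType d} {R : realType} (P : probability T R)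
  (U : nat -> T -> R) (V : T -> R) : Prop :=
  forall e rho : R, 0 < e -> 0 < rho ->
    exists N0, forall N, (N0 <= N)%N -> fpr P [set w | e < `|U N w - V w|] <= rho.

Lemma measurable_homsum_partial {d} {T : measurableType d} {R : realType} (X : nat -> T -> R)
    (p : nat) (f : ('I_p -> nat) -> R) (N : nat) :
  (forall i, measurable_fun setT (X i)) -> measurable_fun setT (homsum_partial X f N).
Proof.
move=> mX; apply: measurable_sum => i; apply: measurable_funM => //.
exact: measurable_prod.
Qed.

Lemma measurable_discretised {d} {T : measurableType d} {R : realType} (X : nat -> T -> R)
    (V : finType) (D : R -> V) (x : nat -> V -> R) i :
  measurable_fun setT (X i) -> (forall v, measurable (D @^-1` [set v])) ->
  measurable_fun setT (discretised X D x i).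
Proof.
move=> mX mD _ B mB; rewrite setTI.
rewrite (_ : _ @^-1` B = (D \o X i) @^-1` (x i @^-1` B))//.
by apply: measurable_finite_range => v; exact: measurable_preimage.
Qed.

Lemma cvg_homsum_partial {T : Type} {R : realType} (Z : nat -> nat -> T -> R) (X : nat -> T -> R)
    (p : nat) (f : ('I_p -> nat) -> R) (N : nat) (w : T) :
  (forall i, Z k i w @[k --> \oo] --> X i w) ->
  homsum_partial (Z k) f N w @[k --> \oo] --> homsum_partial X f N w.
Proof.
move=> ZX; apply: cvg_big => [|i _]; first exact: add_continuous.
apply: cvgM; first exact: cvg_cst.
by apply: cvg_big => [|j _]; [exact: mul_continuous|exact: ZX].
Qed.

Section InProbability.
Context {d} {T : measurableType d} {R : realType} (P : probability T R).

Lemma cvg_pointwise_in_prob (U : nat -> T -> R) (V : T -> R) :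
  (forall n, measurable_fun setT (U n)) -> measurable_fun setT V ->
  (forall w, U n w @[n --> \oo] --> V w) -> cvg_in_prob P U V.
Proof.
move=> mU mV UV e rho e0 rho0.
have mUV n : measurable_fun setT (fun w => U n w - V w) by exact: measurable_funB.
have ae0 : {ae P, forall w, (fun n => U n w - V w) @ \oo --> (0 : R)}.
  apply: aeW => w; rewrite -(subrr (V w)).
  by apply: cvgB; [exact: UV|exact: cvg_cst].
have [m mP] := exceeds_tail_small (U := fun n w => U n w - V w) mUV ae0 e0 rho0.
exists m => N mN; apply: le_trans mP; apply: fpr_le.
- exact: (measurable_norm_gt _ (mUV N)).
- exact: measurable_exceeds_tail.
- by move=> w /= h; exists (N - m)%N => //=; rewrite subnKC.
Qed.

Lemma fpr_exists_le (L : finType) (A : L -> T -> bool) :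
  (forall l, measurable [set w | A l w]) ->
  measurable [set w | [exists l, A l w]] /\
  fpr P [set w | [exists l, A l w]] <= \sum_l fpr P [set w | A l w].
Proof.
move=> mA.
have E : [set w | [exists l, A l w]] = \big[setU/set0]_(l <- index_enum L) [set w | A l w].
  rewrite -bigcup_seq; apply/seteqP; split=> w /=.
    by move=> /existsP[l Al]; exists l => //=; rewrite mem_index_enum.
  by move=> [l _ Al]; apply/existsP; exists l.
rewrite E; elim: (index_enum L) => [|l s [ms IH]].
  by rewrite !big_nil; split=> //; rewrite /fpr measure0.
rewrite !big_cons; split; first exact: measurableU.
by apply: le_trans (fprU_le P (mA l) ms) _; rewrite lerD2l.
Qed.

Lemma cvg_in_prob_finite (L : finType) (U : L -> nat -> T -> R) (V : L -> T -> R) (e rho : R) :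
  (forall l n, measurable_fun setT (U l n)) -> (forall l, measurable_fun setT (V l)) ->
  (forall l, cvg_in_prob P (U l) (V l)) -> 0 < e -> 0 < rho ->
  exists N0, forall N, (N0 <= N)%N ->
    fpr P [set w | [exists l, e < `|U l N w - V l w|]] <= rho.
Proof.
move=> mU mV UV e0 rho0.
(* The successor keeps the share of each index positive when [L] is empty. *)
have c0 : 0 < rho / (#|L|.+1%:R) by rewrite divr_gt0.
have /choice[N0 N0P] := fun l => UV l e _ e0 c0.
exists (\max_l N0 l) => N NP.
have mA l : measurable [set w | e < `|U l N w - V l w|].
  by apply: (measurable_norm_gt (U := fun w => U l N w - V l w)); exact: measurable_funB.
have [_ /le_trans] := fpr_exists_le mA; apply.
apply: (@le_trans _ _ (\sum_(l : L) rho / (#|L|.+1%:R))).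
  apply: ler_sum => l _; apply: N0P; apply: leq_trans NP.
  exact: leq_bigmax.
rewrite sumr_const -[leLHS]mulr_natr -mulrA ler_piMr ?(ltW rho0)//.
by rewrite mulrC ler_pdivrMr// mul1r ler_nat.
Qed.

End InProbability.

(** On a finite window all components are approximated, outside a small event, by partial sums in
    discretised variables. There [discrete_maximal] bounds the component of order [p] by the full
    sum, whose tail is small by hypothesis. *)
Lemma component_ae_cvg0 {d} {T : measurableType d} {R : realType} (P : probability T R)
    (q p : nat) (X : nat -> T -> R) (f : nat -> forall r : nat, ('I_r -> nat) -> R)
    (G : nat -> nat -> T -> R) (delta M : R) :
  (p <= q)%N ->
  (forall i, measurable_fun setT (X i)) -> mutually_independent P X ->
  (forall i, 'E_P[X i] = 0)%E ->
  (forall i, 'E_P[fun w => (X i w ^+ 2)%R] = 1)%E ->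
  0 < delta ->
  (forall j, ('E_P[fun w => (`|X j w| `^ (2 + delta))%R] <= M%:E)%E) ->
  (forall n r, (r <= q)%N -> forall (i : 'I_r -> nat) k l, k != l -> i k = i l -> f n r i = 0) ->
  (forall n r, (r <= q)%N -> measurable_fun setT (G n r)) ->
  (forall n r, (r <= q)%N -> cvg_in_prob P (homsum_partial X (f n r)) (G n r)) ->
  {ae P, forall w, (fun n => \sum_(r < q.+1) G n r w) @ \oo --> (0 : R)} ->
  {ae P, forall w, (fun n => G n p w) @ \oo --> (0 : R)}.
Proof.
move=> pq mX indX EX EX2 delta0 EXd fdiag mG homG aeH.
have [K K1 [k0 disc]] := exists_discretisation mX EX EX2 delta0 EXd.
have half01 : 0 < (2^-1 : R) <= 1 by apply/andP; split; lra.
have [C [B [C0 B0 maxi]]] := @discrete_maximal R q p K 2^-1 K1 half01 pq.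
(* The alphabet varies with [k]; packing the rounded variables as real functions [Z k] makes a
   sequence of them. The shift by [k0.+1] passes the threshold and keeps the denominator
   positive. *)
have {disc} /choice[Z ZP] : forall k, exists Z : nat -> R -> R,
   exists (V : finType) (D : R -> V) (x : nat -> V -> R),
    [/\ forall v, measurable (D @^-1` [set v]),
        forall N, admissible K (2^-1) (@discrete_law d T R P X V D N) (fun (i : 'I_N) v => x i v),
        forall i y, Z i y = x i (D y) &
        forall i y, `|Z i y - y| <= (3 + y ^+ 2) / (k0.+1 + k)%:R].
  move=> k; have [V [D [x [mD adm xD]]]] := disc (k0.+1 + k)%N (leq_trans (leqnSn _) (leq_addr _ _)).
  by exists (fun i y => x i (D y)), V, D, x.
have Zcvg i w : Z k i (X i w) @[k --> \oo] --> X i w.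
  apply/cvgrPdist_le => e e0.
  exists (Num.truncn ((3 + X i w ^+ 2) / e)).+1 => // k /= kP.
  have [V [D [x [_ _ _ ZX]]]] := ZP k.
  rewrite distrC; apply: le_trans (ZX _ _) _.
  rewrite ler_pdivrMr ?ltr0n// mulrC -ler_pdivrMr//.
  have y0 : 0 <= (3 + X i w ^+ 2) / e.
    by rewrite divr_ge0 ?(ltW e0)// addr_ge0 ?sqr_ge0.
  have /andP[_ /ltW h] := truncn_itv y0.
  by apply: le_trans h _; rewrite ler_nat (leq_trans kP)// leq_addl.
have mZ k i : measurable_fun setT (fun w => Z k i (X i w)).
  have [V [D [x [mD _ ZE _]]]] := ZP k.
  rewrite (_ : (fun w => _) = discretised X D x i); first exact: measurable_discretised.
  by apply/funext => w; rewrite ZE.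
apply: ae_cvg0_exceeds => [n|e rho e0 rho0]; first exact: mG.
pose H n w := \sum_(r < q.+1) G n r w.
have mH n : measurable_fun setT (H n).
  by apply: measurable_sum => r; apply: mG; rewrite -ltnS.
pose eps := e / (2 * C).
have eps0 : 0 < eps by rewrite divr_gt0// mulr_gt0.
have eE : C * eps = e / 2 by rewrite /eps; field; lra.
have eps2 : 0 < eps / 2 by lra.
have rB : 0 < rho / (2 * B) by rewrite divr_gt0// mulr_gt0.
have [m mP] := exceeds_tail_small mH aeH eps2 rB.
(* [m] is fixed before [k]; the truncation [N] and the discretisation [j] may depend on the
   window. *)
exists m => k.
(* The first bound serves the component [p] alone; the second keeps the total error of the [q + 1]
   components below [eps / 2]. *)
pose al := Num.min (e / 2) (eps / (2 * q.+1%:R)).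
have al0 : 0 < al by rewrite lt_min !divr_gt0// mulr_gt0.
have al2 : 0 < al / 2 by lra.
(* The two bad events cost [2 * be] inside the maximal inequality, multiplied by [B], and [2 * be]
   outside: in total [rho / 2]. *)
pose be := rho / (4 * (B + 1)).
have be0 : 0 < be by rewrite divr_gt0// mulr_gt0//; lra.
pose L := ('I_k * 'I_q.+1)%type.
have rq (l : L) : (l.2 <= q)%N by rewrite -ltnS.
pose U1 (l : L) N : T -> R := homsum_partial X (f (m + l.1)%N l.2) N.
pose V1 (l : L) : T -> R := G (m + l.1)%N l.2.
have mU1 l N : measurable_fun setT (U1 l N) by exact: measurable_homsum_partial.
have mV1 l : measurable_fun setT (V1 l) by exact: mG.
have cv1 l : cvg_in_prob P (U1 l) (V1 l) by exact: homG.
have [N /(_ N (leqnn N)) NP] := cvg_in_prob_finite mU1 mV1 cv1 al2 be0.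
pose Y j i w := Z j i (X i w).
pose U2 (l : L) j : T -> R := homsum_partial (Y j) (f (m + l.1)%N l.2) N.
have mU2 l j : measurable_fun setT (U2 l j).
  by apply: measurable_homsum_partial => i; exact: mZ.
have cv2 l : cvg_in_prob P (U2 l) (U1 l N).
  apply: cvg_pointwise_in_prob => // w; apply: cvg_homsum_partial => i; exact: Zcvg.
have [j /(_ j (leqnn j)) jP] := cvg_in_prob_finite mU2 (fun l => mU1 l N) cv2 al2 be0.
have [V [D [x [mD adm ZE _]]]] := ZP j.
have YE : Y j = discretised X D x.
  by apply/funext => i; apply/funext => w; rewrite /Y ZE.
pose bad1 := [set w | [exists l, al / 2 < `|U1 l N w - V1 l w|]].
pose bad2 := [set w | [exists l, al / 2 < `|U2 l j w - U1 l N w|]].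
have mbad1 : measurable bad1.
  apply: (fpr_exists_le P _).1 => l.
  by apply: (measurable_norm_gt (U := fun w => U1 l N w - V1 l w)); exact: measurable_funB.
have mbad2 : measurable bad2.
  apply: (fpr_exists_le P _).1 => l.
  by apply: (measurable_norm_gt (U := fun w => U2 l j w - U1 l N w)); exact: measurable_funB.
have good w l : ~ bad1 w -> ~ bad2 w -> `|U2 l j w - V1 l w| <= al.
  move=> /negP; rewrite negb_exists => /forallP/(_ l); rewrite -leNgt => g1.
  move=> /negP; rewrite negb_exists => /forallP/(_ l); rewrite -leNgt => g2.
  have -> : U2 l j w - V1 l w = (U2 l j w - U1 l N w) + (U1 l N w - V1 l w) by ring.
  by apply: le_trans (ler_normD _ _) _; lra.
have := maxi d T P X V D x N 'I_k (fun i => f (m + i)%N) eps mX indX mD (adm N)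
  (fun i r rq' => fdiag (m + i)%N r rq') eps0.
rewrite -YE; set A1 := [set w | _]; set A2 := [set w | _] => A12.
have mA1 : measurable A1.
  apply: (fpr_exists_le P _).1 => i; apply: measurable_norm_gt.
  by apply: measurable_homsum_partial => i'; exact: mZ.
have mA2 : measurable A2.
  apply: (fpr_exists_le P _).1 => i; apply: measurable_norm_gt.
  by apply: measurable_sum => r; apply: measurable_homsum_partial => i'; exact: mZ.
have mGp n : measurable_fun setT (G n p) by exact: mG.
pose bad := bad1 `|` bad2.
have mbad : measurable bad by exact: measurableU.
have badle : fpr P bad <= 2 * be.
  by apply: le_trans (fprU_le P mbad1 mbad2) _; move: NP jP; rewrite -/bad1 -/bad2; lra.
have nbad w : ~ bad w -> ~ bad1 w /\ ~ bad2 w by move=> nb; split=> b; apply: nb; [left|right].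
have S1 : exceeds (fun n => G n p) e m k `<=` A1 `|` bad.
  move=> w /existsP[i ei]; have [bw|/nbad[nb1 nb2]] := pselect (bad w); [by right|left].
  apply/existsP; exists i; rewrite eE.
  have := good w (i, Ordinal (pq : (p < q.+1)%N)) nb1 nb2; rewrite /U2 /V1/= => ga.
  have ale : al <= e / 2 by rewrite ge_min lexx.
  have := ler_distD (homsum_partial (Y j) (f (m + i)%N p) N w) (G (m + i)%N p w) 0.
  rewrite !subr0 [`|G _ _ _ - _|]distrC; lra.
have S2 : A2 `<=` exceeds_tail H (eps / 2) m `|` bad.
  move=> w /existsP[i ei]; have [bw|/nbad[nb1 nb2]] := pselect (bad w); [by right|left].
  exists (i : nat) => //=.
  have ale : al * q.+1%:R <= eps / 2.
    rewrite -ler_pdivlMr ?ltr0n//.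
    have -> : eps / 2 / q.+1%:R = eps / (2 * q.+1%:R) by rewrite invfM mulrA.
    by rewrite ge_min lexx orbT.
  have : `|\sum_(r < q.+1) homsum_partial (Y j) (f (m + i)%N r) N w - H (m + i)%N w| <= al * q.+1%:R.
    rewrite -sumrB; apply: le_trans (ler_norm_sum _ _ _) _.
    apply: (@le_trans _ _ (\sum_(r < q.+1) al)).
      by apply: ler_sum => r _; exact: (good w (i, r)).
    by rewrite sumr_const card_ord -[leLHS]mulr_natr.
  have := ler_distD (H (m + i)%N w) (\sum_(r < q.+1) homsum_partial (Y j) (f (m + i)%N r) N w) 0.
  by rewrite !subr0; move: ei; lra.
have mtail : measurable (exceeds_tail H (eps / 2) m) by exact: measurable_exceeds_tail.
have P1 : fpr P (exceeds (fun n => G n p) e m k) <= fpr P A1 + fpr P bad.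
  apply: le_trans (fprU_le P mA1 mbad); apply: fpr_le => //; last exact: measurableU.
  exact: measurable_exceeds.
have P2 : fpr P A2 <= rho / (2 * B) + 2 * be.
  apply: le_trans (fpr_le P mA2 _ S2) _; first exact: measurableU.
  by apply: le_trans (fprU_le P mtail mbad) _; exact: lerD.
have P3 : B * fpr P A2 <= B * (rho / (2 * B) + 2 * be) by rewrite ler_pM2l.
have E3 : B * (rho / (2 * B) + 2 * be) + 2 * be = rho.
  by rewrite /be; field; apply/andP; split; lra.
lra.
Qed.

(** * Differences of homogeneous sums and the conclusion *)

Section HomsumConvergence.
Context {d} {T : measurableType d} {R : realType} (P : probability T R).

(** Chebyshev's inequality, obtained by integrating [e ^ 2] times the indicator of the event. *)
Lemma cvg_in_prob_homsum (X : nat -> T -> R) (p : nat) (f : ('I_p -> nat) -> R) (G : T -> R) :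
  (forall i, measurable_fun setT (X i)) -> is_homsum P X f G ->
  cvg_in_prob P (homsum_partial X f) G.
Proof.
move=> mX [mG]; rewrite unlock => /fine_cvgP[[N1 _ N1P] /cvgr0Pnorm_lt cv] e rho e0 rho0.
have re : 0 < rho * e ^+ 2 by rewrite mulr_gt0// exprn_gt0.
have [N2 _ N2P] := cv _ re.
exists (maxn N1 N2) => N; rewrite geq_max => /andP[NN1 NN2].
have /= fin := N1P N NN1; have /= := N2P N NN2.
have mD : measurable_fun setT (fun w => homsum_partial X f N w - G w).
  by apply: measurable_funB => //; exact: measurable_homsum_partial.
have mA : measurable [set w | e < `|homsum_partial X f N w - G w|].
  exact: (measurable_norm_gt _ mD).
set A := [set w | _] in mA *.
rewrite ger0_norm; last first.
  by apply: fine_ge0; apply: integral_ge0 => w _; rewrite lee_fin sqr_ge0.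
move=> /ltW small; rewrite -(ler_pM2r (exprn_gt0 2 e0)); apply: le_trans small.
rewrite -lee_fin fineK// EFinM fprK// muleC.
rewrite -[in leLHS](setIT A) -integral_indic// -integralZl//; last exact: integrable_indic.
apply: ge0_le_integral => //.
- by move=> w _; rewrite -EFinM lee_fin mulr_ge0 ?sqr_ge0.
- by apply: (measurable_int P); apply: integrableZl => //; exact: integrable_indic.
- by apply/measurable_EFinP; exact: measurable_funX.
- move=> w _; rewrite -EFinM lee_fin indicE.
  have [/set_mem Aw|_] := boolP (w \in A); last by rewrite mulr0 sqr_ge0.
  by rewrite mulr1 -[leRHS]real_normK ?num_real// ler_pXn2r ?nnegrE ?(ltW e0)// ltW.
Qed.

Lemma cvg_in_probB (U U' : nat -> T -> R) (V V' : T -> R) :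
  (forall n, measurable_fun setT (U n)) -> (forall n, measurable_fun setT (U' n)) ->
  measurable_fun setT V -> measurable_fun setT V' ->
  cvg_in_prob P U V -> cvg_in_prob P U' V' ->
  cvg_in_prob P (fun n w => U n w - U' n w) (fun w => V w - V' w).
Proof.
move=> mU mU' mV mV' UV UV' e rho e0 rho0.
have e2 : 0 < e / 2 by lra.
have r2 : 0 < rho / 2 by lra.
have [N1 N1P] := UV _ _ e2 r2; have [N2 N2P] := UV' _ _ e2 r2.
exists (maxn N1 N2) => N; rewrite geq_max => /andP[/N1P h1 /N2P h2].
have mA1 : measurable [set w | e / 2 < `|U N w - V w|].
  by apply: (measurable_norm_gt (U := fun w => U N w - V w)); exact: measurable_funB.
have mA2 : measurable [set w | e / 2 < `|U' N w - V' w|].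
  by apply: (measurable_norm_gt (U := fun w => U' N w - V' w)); exact: measurable_funB.
have := fprU_le P mA1 mA2 => h.
apply: (@le_trans _ _ (rho / 2 + rho / 2)); last by lra.
apply: le_trans (lerD h1 h2); apply: le_trans h; apply: fpr_le.
- apply: (measurable_norm_gt (U := fun w => U N w - U' N w - (V w - V' w))).
  by apply: measurable_funB; exact: measurable_funB.
- exact: measurableU.
- move=> w /= ew; have [|le1] := ltP (e / 2) `|U N w - V w|; [by left|right].
  rewrite ltNge; apply/negP => le2; move: ew; apply/negP; rewrite -leNgt.
  have -> : U N w - U' N w - (V w - V' w) = (U N w - V w) - (U' N w - V' w) by ring.
  by apply: le_trans (ler_normB _ _) _; lra.
Qed.

(** Extracts deterministic facts, such as finiteness or convergence of means, from almost sure
    statements. *)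
Lemma ae_ex (Q : T -> Prop) : {ae P, forall w, Q w} -> exists w, Q w.
Proof.
move=> aeQ; apply: contrapT => nQ.
have : P setT = 0%E.
  apply: measure_negligible => //; apply: negligibleS aeQ => w _ Qw.
  by apply: nQ; exists w.
have := probability_setT P => P1 P0.
have : (1 : \bar R)%E = 0%E by rewrite -P1 -P0.
by move=> /eqP; rewrite eqe oner_eq0.
Qed.

Lemma homsum_partialB (X : nat -> T -> R) (p : nat) (f g : ('I_p -> nat) -> R) N w :
  homsum_partial X (fun i => f i - g i) N w = homsum_partial X f N w - homsum_partial X g N w.
Proof. by rewrite /homsum_partial -sumrB; apply: eq_bigr => i _; rewrite mulrBl. Qed.

Lemma homsum_partial0 (X : nat -> T -> R) (c : R) N w :
  homsum_partial X ((fun=> c) : ('I_0 -> nat) -> R) N w = c.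
Proof.
rewrite /homsum_partial; under eq_bigr do rewrite big_ord0 mulr1.
by rewrite sumr_const card_ffun !card_ord expn0.
Qed.

End HomsumConvergence.

Theorem theorem1p3 (d : measure_display) (T : measurableType d) (R : realType)
  (P : probability T R) (q : nat) (X : nat -> T -> R)
  (fn : nat -> forall p : nat, ('I_p -> nat) -> R)
  (f : forall p : nat, ('I_p -> nat) -> R)
  (Gn : nat -> nat -> T -> R) (G : nat -> T -> R)
  (Fn : nat -> T -> R) (F : T -> R) :
  (2 <= q)%N ->
  (forall i, measurable_fun setT (X i)) ->
  mutually_independent P X ->
  (forall i, 'E_P[X i] = 0)%E ->
  (forall i, 'E_P[fun w => (X i w ^+ 2)%R] = 1)%E ->
  (exists (delta : R) (M : R), 0 < delta /\
     forall j, ('E_P[fun w => (`|X j w| `^ (2 + delta))%R] <= M%:E)%E) ->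
  (forall n, measurable_fun setT (Fn n)) ->
  measurable_fun setT F ->
  (forall n p, (1 <= p <= q)%N -> l2_0_sym (fn n p)) ->
  (forall n p, (1 <= p <= q)%N -> is_homsum P X (fn n p) (Gn n p)) ->
  (forall n, {ae P, forall w,
     (Fn n w)%:E = ('E_P[Fn n] + (\sum_(1 <= p < q.+1) Gn n p w)%:E)%E}) ->
  (forall p, (1 <= p <= q)%N -> l2_0_sym (f p)) ->
  (forall p, (1 <= p <= q)%N -> is_homsum P X (f p) (G p)) ->
  {ae P, forall w, (F w)%:E = ('E_P[F] + (\sum_(1 <= p < q.+1) G p w)%:E)%E} ->
  {ae P, forall w, Fn ^~ w @ \oo --> F w} ->
  ('E_P[Fn n] @[n --> \oo] --> 'E_P[F])%E /\
  (forall p, (1 <= p <= q)%N ->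
     {ae P, forall w, (fun n => Gn n p w) @ \oo --> G p w}).
Proof.
move=> _ mX indX EX EX2 [delta [M [delta0 EXd]]] mFn mF fnP Gn_homsum FnE fP G_homsum FE aeF.
(* At a point where the identity holds, an infinite mean would make the right side infinite while
   [Fn n w] is real. *)
have EFn_fin n : ('E_P[Fn n] \is a fin_num)%E.
  have [w /= e] := ae_ex (FnE n).
  by case: ('E_P[Fn n])%E e.
have EF_fin : ('E_P[F] \is a fin_num)%E.
  have [w /= e] := ae_ex FE.
  by case: ('E_P[F])%E e.
(* The difference of the means becomes the component of order 0, so means and homogeneous sums are
   treated by the same lemma. *)
pose c n := fine ('E_P[Fn n])%E - fine ('E_P[F])%E.
pose h n r : ('I_r -> nat) -> R :=
  match r with 0 => fun=> c n | s.+1 => fun i => fn n s.+1 i - f s.+1 i end.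
pose L n r w := if r is s.+1 then Gn n s.+1 w - G s.+1 w else c n.
have mGn n r : (1 <= r <= q)%N -> measurable_fun setT (Gn n r) by move=> /(Gn_homsum n)[].
have mG r : (1 <= r <= q)%N -> measurable_fun setT (G r) by move=> /G_homsum[].
have hdiag n r : (r <= q)%N -> forall (i : 'I_r -> nat) k l, k != l -> i k = i l -> h n r i = 0.
  case: r => [_ i []//|r rq i k l kl ikl] /=.
  have [_ fn0 _] := fnP n r.+1 rq; have [_ f0 _] := fP r.+1 rq.
  by rewrite (fn0 _ _ _ kl ikl) (f0 _ _ _ kl ikl) subrr.
have mL n r : (r <= q)%N -> measurable_fun setT (L n r).
  case: r => [_|r rq] /=; first exact: measurable_cst.
  by apply: measurable_funB; [exact: mGn|exact: mG].
have hL n r : (r <= q)%N -> cvg_in_prob P (homsum_partial X (h n r)) (L n r).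
  case: r => [_|r rq].
    move=> e rho e0 rho0; exists 0%N => N _.
    rewrite (_ : [set w | _] = set0) ?/fpr ?measure0 ?(ltW rho0)//.
    apply/seteqP; split=> w //=; rewrite homsum_partial0 subrr normr0.
    by move=> /(lt_trans e0); rewrite ltxx.
  have -> : homsum_partial X (h n r.+1) = fun N w =>
      homsum_partial X (fn n r.+1) N w - homsum_partial X (f r.+1) N w.
    by apply/funext => N; apply/funext => w; rewrite -homsum_partialB.
  apply: cvg_in_probB => [N|N||||].
  - exact: measurable_homsum_partial.
  - exact: measurable_homsum_partial.
  - exact: mGn.
  - exact: mG.
  - by apply: cvg_in_prob_homsum => //; exact: Gn_homsum.
  - by apply: cvg_in_prob_homsum => //; exact: G_homsum.
have aeL : {ae P, forall w, (fun n => \sum_(r < q.+1) L n r w) @ \oo --> (0 : R)}.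
  (* The countably many identities for [Fn n] hold simultaneously outside one null set. *)
  move: (ae_foralln FnE) FE aeF; apply: filterS3 => w FnEw FEw cvF.
  rewrite (_ : (fun n => _) = (fun n => Fn n w - F w)).
    by rewrite -(subrr (F w)); apply: cvgB; [exact: cvF|exact: cvg_cst].
  apply/funext => n; have := FnEw n; have := FEw.
  rewrite -(fineK (EFn_fin n)) -(fineK EF_fin) -!EFinD => -[->] [->].
  rewrite big_ord_recl /= !big_add1 /= !big_mkord sumrB /c; ring.
have aeLp p : (p <= q)%N -> {ae P, forall w, (fun n => L n p w) @ \oo --> (0 : R)}.
  move=> pq; exact: (component_ae_cvg0 pq mX indX EX EX2 delta0 EXd hdiag mL hL aeL).
split.
  (* [c n] is deterministic, so convergence at a single point gives convergence of the means. *)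
  have [w cw] := ae_ex (aeLp 0%N (leq0n q)).
  rewrite -(fineK EF_fin); apply/fine_cvgP; split; first by apply: nearW => n; exact: EFn_fin.
  rewrite -[X in _ --> X]add0r.
  rewrite (_ : fine \o _ = (fun n => c n + fine ('E_P[F])%E)).
    by apply: cvgD; [exact: cw|exact: cvg_cst].
  by apply/funext => n; rewrite /c/= subrK.
move=> [//|p] pq; have := aeLp p.+1 pq; apply: filterS => w /= cw.
rewrite -[X in _ --> X]add0r.
rewrite (_ : (fun n => _) = (fun n => (Gn n p.+1 w - G p.+1 w) + G p.+1 w)).
  by apply: cvgD; [exact: cw|exact: cvg_cst].
by apply/funext => n; rewrite subrK.
Qed.
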